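(* Let $M$ be a connected compact topological manifold, possibly with boundary, let $\varphi$ be a continuous flow on $M$ and let $\alpha\in H^1(M,\mathbb R)$. If $\alpha$ is quasi-Lyapunov, then there exists a Lyapunov and $\alpha$-equivariant map $f\colon\widehat M_\alpha\to\mathbb R$.
   Context: Flows are defined for all times; $M$ carries a metric compatible with its topology. Coverings. $\widehat M\to M$ is the universal Abelian covering of $M$; its deck group is $H_1(M,\mathbb Z)$, and the action is written $\delta\cdot x$. A class $\alpha\in H^1(M,\mathbb R)$ is viewed as a homomorphism $H_1(M,\mathbb Z)\to\mathbb R$, with kernel $\ker_{\mathbb Z}(\alpha)$. Set $\widehat M_\alpha=\widehat M/\ker_{\mathbb Z}(\alpha)$, a covering of $M$ on which $H_1(M,\mathbb Z)$ acts by deck transformations. The flow lifts to $\widehat M$ and $\widehat M_\alpha$. Covering spaces of $M$ carry a metric invariant under deck transformations for which the projection to $M$ restricted to every ball of sufficiently small radius is an isometry onto its image. A function $f$ on $\widehat M$ or $\widehat M_\alpha$ is $\alpha$-equivariant if $f(\delta\cdot x)=f(x)+\alpha(\delta)$ for all $\delta\in H_1(M,\mathbb Z)$ and all $x$. Pseudo-orbits. Let $N$ be $M$ or one of these coverings, with its flow $\psi$ and metric $d$, and fix $T>0$. For $\epsilon>0$, an $\epsilon$-pseudo-orbit is a right-continuous map $\gamma\colon[0,l)\to N$, $l>0$ (the length $\mathrm{len}(\gamma)$), continuous outside a finite set $\Delta\subset[T,l)$ whose distinct points are at distance at least $T$ from each other, such that $\gamma(s)=\psi_{s-t}(\gamma(t))$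 whenever $\gamma$ is continuous on $[t,s]$, and $d(\gamma(u),\gamma(u^-))<\epsilon$ for $u\in\Delta$, where $\gamma(u^-)=\lim_{t\to u^-}\gamma(t)$. It goes from $\gamma(0)$ to $\gamma(l^-)$. Write $x\rightsquigarrow y$ if for every $\epsilon>0$ there is an $\epsilon$-pseudo-orbit from $x$ to $y$ (this does not depend on $T$). A point $x$ is recurrent if $x\rightsquigarrow x$; recurrence chains are the classes of the equivalence relation ($x\rightsquigarrow y$ and $y\rightsquigarrow x$) on the set of recurrent points (the recurrent set). A continuous map $f\colon N\to\mathbb R$ is Lyapunov if it is constant on every recurrence chain, takes distinct values on distinct recurrence chains, and is (strictly) decreasing along the flow outside the recurrent set. A continuous $\alpha$-equivariant map $f\colon\widehat M\to\mathbb R$ is quasi-Lyapunov if there are $C\ge0$ and $\epsilon>0$ such that $f(\gamma(0))\ge f(\gamma(t))-C$ for every $\epsilon$-pseudo-orbit $\gamma$ in $\widehat M$ and every $t\in[0,\mathrm{len}(\gamma))$. The class $\alpha$ is quasi-Lyapunov if every continuous $\alpha$-equivariant map $\widehat M\to\mathbb R$ is quasi-Lyapunov. *)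

(* Defs.v *)
From HB Require Import structures.
From mathcomp Require Import freeg.
From mathcomp Require Import all_boot all_order all_algebra ring_quotient.
From mathcomp Require Import all_classical all_reals all_analysis.

Set Implicit Arguments.
Unset Strict Implicit.
Unset Printing Implicit Defensive.

Import Order.TTheory GRing.Theory Num.Theory.
Import numFieldNormedType.Exports.

Local Open Scope classical_set_scope.
Local Open Scope ring_scope.

Definition std_simplex (R : realType) (n : nat) : set 'rV[R]_n.+1 :=
  [set v | (forall i, 0 <= v 0 i) /\ \sum_i v 0 i = 1].
Arguments std_simplex : clear implicits.

Section SingularHomology.
Variable R : realType.

Lemma vertex_subproof n (i : 'I_n.+1) :
  (delta_mx 0 i : 'rV[R]_n.+1) \in std_simplex R n.
Proof.
apply/mem_set; split=> [j|]; first by rewrite mxE ler0n.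
rewrite (bigD1 i)//= big1 ?addr0 => [|j /negbTE ji]; first by rewrite mxE !eqxx.
by rewrite mxE ji andbF.
Qed.

Definition vertex n (i : 'I_n.+1) : std_simplex R n :=
  exist (fun v => v \in std_simplex R n) (delta_mx 0 i) (vertex_subproof i).

Definition face_row n (i : 'I_n.+2) (v : 'rV[R]_n.+1) : 'rV[R]_n.+2 :=
  \row_j (if unlift i j is Some k then v 0 k else 0).

Lemma face_subproof n (i : 'I_n.+2) (v : std_simplex R n) :
  face_row i (set_val v) \in std_simplex R n.+1.
Proof.
apply/mem_set; have [v0 v1] := set_valP v; split=> [j|].
  by rewrite mxE; case: unliftP => /=.
rewrite -v1 (bigD1_ord i)//= mxE unlift_none add0r.
by apply: eq_bigr => j _; rewrite mxE liftK.
Qed.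

Definition face n (i : 'I_n.+2) (v : std_simplex R n) : std_simplex R n.+1 :=
  exist (fun v => v \in std_simplex R n.+1) (face_row i (set_val v))
    (face_subproof i v).

Lemma face_row_continuous n (i : 'I_n.+2) : continuous (@face_row n i).
Proof.
move=> v A /= [B vB BA]; rewrite nbhs_simpl/=.
exists (fun=> fun k => B ord0 (lift i k)).
  by move=> j k; have := vB ord0 (lift i k); rewrite mxE liftK (ord1 j).
move=> w Bw; apply: BA => j l; rewrite mxE (ord1 j).
case: unliftP => [m -> | lE]; first exact: Bw ord0 m.
by have := nbhs_singleton (vB ord0 l); rewrite mxE lE unlift_none.
Qed.

Lemma face_continuous n (i : 'I_n.+2) : continuous (@face n i).
Proof.
apply: continuous_comp_initial => v /=.
apply: (@continuous_comp _ _ _ set_val (face_row i)).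
  exact: initial_continuous.
exact: face_row_continuous.
Qed.

HB.instance Definition _ n i := isContinuous.Build _ _ _ (@face_continuous n i).

Definition singular_simplex (n : nat) (X : topologicalType) :=
  continuousType (std_simplex R n) X.

Definition chain (n : nat) (X : topologicalType) :=
  {freeg (singular_simplex n X) / int}.
HB.instance Definition _ n X := GRing.Lmodule.on (chain n X).

Definition simplex_chain n (X : topologicalType)
  (s : singular_simplex n X) : chain n X := Freeg [:: (1, s)].

(* face i forgets the i-th vertex, so that the boundary of a path is its
   endpoint (vertex 1) minus its starting point (vertex 0). *)
Definition boundary n (X : topologicalType) : chain n.+1 X -> chain n X :=
  fglift (fun s : singular_simplex n.+1 X =>
    \sum_(i < n.+2) (-1) ^+ i *: simplex_chain (s \o @face n i)).

Lemma boundary_is_additive n (X : topologicalType) :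
  additive (@boundary n X).
Proof. exact: lift_is_additive. Qed.

HB.instance Definition _ n X :=
  GRing.isAdditive.Build (chain n.+1 X) (chain n X) (@boundary n X)
    (@boundary_is_additive n X).

Section FirstHomology.
Variable X : topologicalType.

Definition is_cycle : {pred chain 1 X} := [pred c | boundary c == 0].

Lemma is_cycle_zmod_closed : zmod_closed is_cycle.
Proof.
split=> [|b c /eqP b0 /eqP c0]; apply/eqP; first exact: raddf0.
by rewrite raddfB /= b0 c0 subrr.
Qed.
HB.instance Definition _ :=
  GRing.isZmodClosed.Build (chain 1 X) is_cycle is_cycle_zmod_closed.

Record cycles := Cycle { cycle_chain : chain 1 X; _ : cycle_chain \in is_cycle }.
HB.instance Definition _ := [isSub for cycle_chain].
HB.instance Definition _ := [Choice of cycles by <:].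
HB.instance Definition _ := [SubChoice_isSubZmodule of cycles by <:].

Definition is_boundary : {pred cycles} :=
  [pred c | `[< exists b : chain 2 X, boundary b = cycle_chain c >]].

Lemma is_boundary_zmod_closed : zmod_closed is_boundary.
Proof.
split=> [|b c /asboolP[b' b'E] /asboolP[c' c'E]]; apply/asboolP.
  by exists 0; rewrite raddf0.
by exists (b' - c'); rewrite raddfB /= b'E c'E.
Qed.
HB.instance Definition _ :=
  GRing.isZmodClosed.Build cycles is_boundary is_boundary_zmod_closed.

Definition H1 : zmodType := Quotient.quot is_boundary.

Definition homology_class (c : cycles) : H1 := \pi_(Quotient.quot is_boundary)%qT c.

End FirstHomology.
End SingularHomology.

Definition homeomorphism_on (X Y : topologicalType) (A : set X) (B : set Y)
    (h : X -> Y) (k : Y -> X) : Prop :=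
  [/\ {homo h : x / A x >-> B x}, {homo k : y / B y >-> A y},
      {within A, continuous h}, {within B, continuous k} &
      (forall x, A x -> k (h x) = x) /\ (forall y, B y -> h (k y) = y)].

(* The first coordinate is the nonnegative one; for n = 0 there is no
   constraint and this is the one-point space. *)
Definition half_space (R : realType) (n : nat) : set 'rV[R]_n :=
  [set v | forall i : 'I_n, i = 0%N :> nat -> 0 <= v 0 i].
Arguments half_space : clear implicits.

Definition manifold_with_boundary (R : realType) (n : nat)
    (X : topologicalType) : Prop :=
  [/\ hausdorff_space X, @second_countable X &
      forall x : X, exists (U : set X) (V : set 'rV[R]_n)
          (h : X -> 'rV[R]_n) (k : 'rV[R]_n -> X),
        [/\ open U, U x, open V &
            homeomorphism_on U (V `&` half_space R n) h k]].

Definition covering_map (E B : topologicalType) (p : E -> B) : Prop :=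
  [/\ continuous p, range p = [set: B] &
      forall b : B, exists (U : set B) (sheets : set (set E)),
        [/\ open U, U b, trivIset sheets id,
            p @^-1` U = \bigcup_(S in sheets) S &
            forall S, sheets S ->
              open S /\ exists k, homeomorphism_on S U p k]].

Section Flows.
Variable R : realType.

Definition flow (N : topologicalType) (psi : R -> N -> N) : Prop :=
  [/\ continuous (fun tx : R * N => psi tx.1 tx.2),
      forall x, psi 0 x = x &
      forall s t x, psi (s + t) x = psi s (psi t x)].

Definition flow_lift (E N : topologicalType) (p : E -> N)
    (psi : R -> N -> N) (psihat : R -> E -> E) : Prop :=
  flow psihat /\ forall t x, p (psihat t x) = psi t (p x).

Section PseudoOrbits.
Variables (N : metricType R) (psi : R -> N -> N) (T : R).

(* A map [0, l) -> N is represented by a total function on R whose values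
   outside [0, l) are irrelevant: every clause below depends only on the
   restriction of gamma to [0, l). *)
Definition pseudo_orbit (eps l : R) (gamma : R -> N) : Prop :=
  0 < l /\
  (forall t, 0 <= t < l -> gamma s @[s --> t^'+] --> gamma t) /\
  exists Delta : set R,
    [/\ finite_set Delta /\ (forall u, Delta u -> T <= u < l),
        forall u v, Delta u -> Delta v -> u != v -> T <= `|u - v|,
        forall t, 0 < t < l -> ~ Delta t -> {for t, continuous gamma},
        forall t s, 0 <= t -> t <= s -> s < l ->
          {within `[t, s], continuous gamma} ->
          gamma s = psi (s - t) (gamma t) &
        forall u, Delta u -> exists2 y : N,
          gamma s @[s --> u^'-] --> y & mdist (gamma u) y < eps].

Definition goes_from_to (l : R) (gamma : R -> N) (x y : N) : Prop :=
  gamma 0 = x /\ gamma s @[s --> l^'-] --> y.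

Definition leads_to (x y : N) : Prop :=
  forall eps : R, 0 < eps ->
    exists l gamma, pseudo_orbit eps l gamma /\ goes_from_to l gamma x y.

Definition recurrent (x : N) : Prop := leads_to x x.

Definition chain_equiv (x y : N) : Prop := leads_to x y /\ leads_to y x.

Definition recurrence_chain (A : set N) : Prop :=
  exists2 x, recurrent x & A = [set y | recurrent y /\ chain_equiv x y].

Definition lyapunov (f : N -> R) : Prop :=
  [/\ continuous f,
      forall A, recurrence_chain A -> forall x y, A x -> A y -> f x = f y,
      forall A B, recurrence_chain A -> recurrence_chain B -> A <> B ->
        forall x y, A x -> B y -> f x <> f y &
      forall x, ~ recurrent x ->
        forall s t, s < t -> f (psi t x) < f (psi s x)].

Definition quasi_lyapunov (f : N -> R) : Prop :=
  exists C eps : R, [/\ 0 <= C, 0 < eps &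
    forall l gamma, pseudo_orbit eps l gamma ->
      forall t, 0 <= t < l -> f (gamma 0) >= f (gamma t) - C].

End PseudoOrbits.
End Flows.

Section AbelianCoverings.
Variables (R : realType) (M : metricType R).

Definition group_action (G : zmodType) (X : Type) (act : G -> X -> X) : Prop :=
  (forall x, act 0 x = x) /\ (forall a b x, act (a + b) x = act a (act b x)).

(* The last clause identifies the deck group with H_1(M, Z): if a path sigma
   of E projects to a loop of M, the class of this loop sends the starting
   point of sigma to its endpoint.  Together with freeness it says that a loop
   of M lifts to loops of E exactly when it is null-homologous. *)
Definition universal_abelian_covering (E : topologicalType)
    (p : continuousType E M) (act : H1 R M -> E -> E) : Prop :=
  [/\ connected [set: E] /\ covering_map p,
      group_action act /\ (forall d, continuous (act d)),
      forall d x, act d x = x -> d = 0,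
      forall x y, p x = p y <-> exists d, y = act d x &
      forall (sigma : singular_simplex R 1 E) (c : cycles R M),
        cycle_chain c = simplex_chain (p \o sigma) ->
        sigma (vertex R ord_max) =
          act (homology_class c) (sigma (vertex R ord0))].

Definition covering_metric (E : metricType R) (p : E -> M)
    (act : H1 R M -> E -> E) : Prop :=
  (forall d x y, mdist (act d x) (act d y) = mdist x y) /\
  exists2 r : R, 0 < r &
    forall x y z : E, ball x r y -> ball x r z ->
      mdist (p y) (p z) = mdist y z.

(* E' is the quotient of E by the kernel of alpha, with the quotient topology,
   q the quotient map, and p', act' are induced by p, act. *)
Definition kernel_quotient (alpha : {additive H1 R M -> R})
    (E : topologicalType) (p : E -> M) (act : H1 R M -> E -> E)
    (E' : topologicalType) (q : E -> E')
    (p' : E' -> M) (act' : H1 R M -> E' -> E') : Prop :=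
  [/\ range q = [set: E'],
      forall A : set E', open A <-> open (q @^-1` A),
      forall x y, q x = q y <-> exists2 d, alpha d = 0 & y = act d x,
      forall x, p' (q x) = p x &
      forall d x, act' d (q x) = q (act d x)].

Definition equivariant (alpha : {additive H1 R M -> R}) (X : Type)
    (act : H1 R M -> X -> X) (f : X -> R) : Prop :=
  forall d x, f (act d x) = f x + alpha d.

Definition quasi_lyapunov_class (alpha : {additive H1 R M -> R})
    (E : metricType R) (act : H1 R M -> E -> E) (psi : R -> E -> E) (T : R) :
    Prop :=
  forall f : E -> R, continuous f -> equivariant alpha act f ->
    quasi_lyapunov psi T f.

End AbelianCoverings.

(* Main.v *)
Require Import Defs.
From mathcomp Require Import all_boot all_order all_algebra.
From mathcomp Require Import all_classical all_reals all_analysis.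
From mathcomp Require Import ring lra.
Import Order.TTheory GRing.Theory Num.Theory.
Import numFieldNormedType.Exports.
Local Open Scope classical_set_scope.
Local Open Scope ring_scope.

Set Implicit Arguments.
Unset Strict Implicit.
Unset Printing Implicit Defensive.

(* Write [reach eps x y] when [y] is obtained from [x] by flowing and making jumps
   smaller than [eps] after waiting times at least [T].  Let [g] be a continuous
   equivariant function on the covering.  Being quasi-Lyapunov bounds the increase
   of [g] along [eps0]-chains, so for [h] at bounded distance below [g] the
   penalized supremum of [h] over the points reachable from [x] is finite; it is a
   continuous equivariant function of [x], decreasing along [eta]-chains for some
   [eta > 0], hence locally constant on the recurrent set.

   These functions, for countably many [h] and [eta], detect whether [b] is
   reachable from [a]: let [h] have a peak along the orbit of [b].  What could
   spoil this is [a] reaching translates of [b] whose heights increase to that of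
   [b] without attaining it.  It does not happen, since after snapping chains to
   the orbit of a finite net the total drop is a sum of elements of a finite set
   of nonnegative reals, so only finitely many heights lie above any given bound.

   The required function is a weighted sum of the countable family.  On pairs of
   recurrent points with a prescribed difference of the first function of the
   family, each function takes finitely many differences, and the prescribed
   differences form a countable set; so weights decreasing fast enough can be
   chosen one after the other to keep distinct chains at distinct values. *)

(** * Neighbourhoods in metric spaces *)

Section MetricFilters.
Variable R : realType.
Import metricType_numDomainType.

Lemma near_mdistP (N : metricType R) (x : N) (P : N -> Prop) :
  (\forall y \near x, P y) <->
  exists2 e : R, 0 < e & forall y, mdist x y < e -> P y.
Proof.
rewrite nbhs_mdistP; split=> -[e /= e0 H]; exists e => //.
Qed.

Lemma near_normP (t : R) (P : R -> Prop) :
  (\forall s \near t, P s) <->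
  exists2 e : R, 0 < e & forall s, `|t - s| < e -> P s.
Proof. by split=> [/nbhs_ballP|H]; [|apply/nbhs_ballP]. Qed.

Lemma near_rightP (t : R) (P : R -> Prop) :
  (\forall s \near t^'+, P s) <->
  exists2 e : R, 0 < e & forall s, t < s -> s < t + e -> P s.
Proof.
split=> [/near_normP[e e0 H]|[e e0 H]].
  exists e => // s ts se; apply: H => //.
  by rewrite ltr0_norm ?subr_lt0// opprB ltrBlDl.
apply/near_normP; exists e => // s tse ts; apply: H => //.
by move: tse; rewrite ltr0_norm ?subr_lt0// opprB ltrBlDl.
Qed.

Lemma near_leftP (t : R) (P : R -> Prop) :
  (\forall s \near t^'-, P s) <->
  exists2 e : R, 0 < e & forall s, t - e < s -> s < t -> P s.
Proof.
split=> [/near_normP[e e0 H]|[e e0 H]].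
  exists e => // s ts se; apply: H => //.
  by rewrite gtr0_norm ?subr_gt0// ltrBlDl -ltrBlDr.
apply/near_normP; exists e => // s tse ts; apply: H => //.
by move: tse; rewrite gtr0_norm ?subr_gt0// ltrBlDl -ltrBlDr.
Qed.

Lemma seq_has_max (s : seq R) : s != [::] ->
  exists2 m, m \in s & forall u, u \in s -> u <= m.
Proof.
elim: s => // a s IH _; have [->|/IH[m ms mM]] := eqVneq s [::].
  by exists a; rewrite ?mem_seq1// => u; rewrite mem_seq1 => /eqP->.
have [am|/ltW ma] := lerP a m.
  exists m; first by rewrite inE ms orbT.
  by move=> u; rewrite inE => /orP[/eqP->|/mM].
exists a; first by rewrite mem_head.
by move=> u; rewrite inE => /orP[/eqP->//|/mM um]; exact: le_trans ma.
Qed.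

End MetricFilters.

(** * Pseudo-orbits and chains *)

Section Chains.
Variables (R : realType) (N : metricType R) (psi : R -> N -> N) (T : R).

(* Pseudo-orbits up to the time spent flowing after the last jump. *)
Inductive reach (eps : R) (x : N) : N -> Prop :=
| reach_refl : reach eps x x
| reach_flow t z : 0 <= t -> reach eps x z -> reach eps x (psi t z)
| reach_jump z w : reach eps x z -> mdist (psi T z) w < eps -> reach eps x w.

Lemma reach_trans eps x y z : reach eps x y -> reach eps y z -> reach eps x z.
Proof.
move=> xy; elim=> // [t w t0 _ IH|w w' _ IH ww'].
  exact: reach_flow.
exact: reach_jump IH ww'.
Qed.

Lemma reach_le e e' x y : e <= e' -> reach e x y -> reach e' x y.
Proof.
move=> ee'; elim=> [|t w t0 _ IH|w w' _ IH ww'].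
- exact: reach_refl.
- exact: reach_flow.
- exact: reach_jump IH (lt_le_trans ww' ee').
Qed.

Hypothesis psiF : flow psi.
Hypothesis T0 : 0 < T.

Lemma flow0 x : psi 0 x = x. Proof. by case: psiF. Qed.

Lemma flowD s t x : psi (s + t) x = psi s (psi t x).
Proof. by case: psiF. Qed.

Lemma flow_continuous_time x : continuous (fun t => psi t x).
Proof.
move=> t; case: psiF => cont _ _.
apply: (@cvg_comp _ _ _ (fun s : R => (s, x)) (fun tx => psi tx.1 tx.2)
  (nbhs t) (nbhs (t, x))); last exact: (cont (t, x)).
by apply: (cvg_pair (cvg_id (F := nbhs t)) (cvg_cst x)).
Qed.

Lemma flow_from_continuous a x : continuous (fun s => psi (s - a) x).
Proof.
move=> t; apply: (@continuous_comp _ _ _ (fun s : R => s - a) (fun s => psi s x)).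
  by apply: cvgB; [exact: cvg_id|exact: cvg_cst].
exact: flow_continuous_time.
Qed.

Lemma flow_segment_limit (gamma : R -> N) a b : a < b ->
  (forall s, a <= s -> s < b -> gamma s = psi (s - a) (gamma a)) ->
  gamma s @[s --> b^'-] --> psi (b - a) (gamma a).
Proof.
move=> ab gflow.
have H : (psi (s - a) (gamma a)) @[s --> b^'-] --> psi (b - a) (gamma a).
  by apply: cvg_at_left_filter; exact: flow_from_continuous.
apply: cvg_trans H; apply: near_eq_cvg.
apply/near_leftP; exists (b - a); first by rewrite subr_gt0.
by move=> s; rewrite opprB addrC subrK => as_ sb; apply/esym/gflow => //; exact: ltW.
Qed.

Lemma flowK t : cancel (psi t) (psi (- t)).
Proof. by move=> x; rewrite -flowD addNr flow0. Qed.

Lemma flowNK t : cancel (psi (- t)) (psi t).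
Proof. by move=> x; rewrite -flowD subrr flow0. Qed.

Section FromPseudoOrbit.
Variables (eps l : R) (gamma : R -> N) (Delta : set R).
Hypothesis right_cont : forall t, 0 <= t < l -> gamma s @[s --> t^'+] --> gamma t.
Hypothesis cont_off :
  forall t, 0 < t < l -> ~ Delta t -> {for t, continuous gamma}.
Hypothesis flow_law : forall t s, 0 <= t -> t <= s -> s < l ->
  {within `[t, s], continuous gamma} -> gamma s = psi (s - t) (gamma t).

(** The flow law only covers intervals where [gamma] is continuous. Here [a] may itself be a jump
    time; continuity at [a] within the interval then comes from right continuity. *)
Lemma jump_free_flow a s : 0 <= a -> a <= s -> s < l ->
  (forall u, Delta u -> a < u -> u <= s -> False) ->
  gamma s = psi (s - a) (gamma a).
Proof.
move=> a0 as_ sl free; apply: flow_law => //.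
apply/subspace_continuousP => t /=; rewrite in_itv/= => /andP[at_ ts] W nW.
have tl : t < l by exact: le_lt_trans sl.
move: at_; rewrite le_eqVlt => /predU1P[aE|at_].
  have := @right_cont t; rewrite -aE a0 aE tl => /(_ isT W).
  rewrite -aE in nW * => /(_ nW) /near_rightP[e e0 H].
  apply/near_normP; exists e => // u aue /=; rewrite in_itv/= => /andP[au us].
  move: au; rewrite le_eqVlt => /predU1P[<-|au]; first exact: nbhs_singleton.
  by apply: H => //; rewrite ltr0_norm ?subr_lt0// opprB ltrBlDl in aue.
have ct : {for t, continuous gamma}.
  apply: cont_off; first by rewrite (le_lt_trans a0 at_).
  by move=> Dt; exact: free Dt at_ ts.
have /near_normP[e e0 H] := ct W nW.
by apply/near_normP; exists e => // u ue _; exact: H.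
Qed.

Lemma jump_free_limit a b : 0 <= a -> a < b -> b <= l ->
  (forall u, Delta u -> a < u -> u < b -> False) ->
  gamma s @[s --> b^'-] --> psi (b - a) (gamma a).
Proof.
move=> a0 ab bl free; apply: flow_segment_limit => // s as_ sb.
apply: jump_free_flow => //; first exact: lt_le_trans bl.
by move=> u Du au us; apply: free Du au _; exact: le_lt_trans sb.
Qed.

End FromPseudoOrbit.

(** Induction on the number of jump times up to [t]. If [u] is the last one, no jump lies strictly
    between [u - T] and [u], so the left limit at [u] is [psi T (gamma (u - T))] and the jump at [u]
    is a [reach_jump] from [gamma (u - T)]. *)
Lemma pseudo_orbit_reach eps l gamma t : pseudo_orbit psi T eps l gamma ->
  0 <= t < l -> reach eps (gamma 0) (gamma t).
Proof.
move=> [l0 [rc [Delta [[finD DT] sep co fl jump]]]].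
have /finite_seqP[s DE] := finD.
have memD u : u \in s <-> Delta u by rewrite DE.
have [n] := ubnP (count (fun u => u <= t) s).
elim: n t => // n IH t; rewrite ltnS => cn /andP[t0 tl].
have [s0|/seq_has_max[u]] := eqVneq [seq u <- s | u <= t] [::].
  rewrite (jump_free_flow rc co fl (lexx 0) t0 tl); last first.
    move=> u /memD us _ ut; have : u \in [seq u <- s | u <= t].
      by rewrite mem_filter ut.
    by rewrite s0.
  by apply: reach_flow; [rewrite subr0|exact: reach_refl].
rewrite mem_filter => /andP[ut us] umax.
have Du : Delta u by exact/memD.
have /andP[Tu ul] := DT u Du.
rewrite (@jump_free_flow l gamma Delta rc co fl u t _ ut tl); last first.
- move=> v /memD vs uv vt; have := umax v; rewrite mem_filter vt vs => /(_ isT).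
  by rewrite leNgt uv.
- by rewrite (le_trans (ltW T0)).
apply: reach_flow; first by rewrite subr_ge0.
have uT0 : 0 <= u - T by rewrite subr_ge0.
have [y yl dy] := jump u Du.
have yE : y = psi T (gamma (u - T)).
  have := @jump_free_limit l gamma Delta rc co fl (u - T) u uT0 _ (ltW ul) _.
  rewrite subKr => H.
  apply: (cvg_unique _ (F := gamma s @[s --> u^'-])) => //=.
    exact: metric_hausdorff.
  apply: H; first by rewrite ltrBlDr ltrDl.
  move=> v Dv uv vu; have /eqP/eqP := lt_eqF vu.
  by move=> vnu; have := sep _ _ Dv Du vnu; rewrite distrC ger0_norm; lra.
apply: (@reach_jump _ _ (gamma (u - T))); last first.
  by rewrite -yE metric_sym.
apply: IH; last by rewrite uT0 (le_lt_trans _ ul)// gerBl ltW.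
apply: leq_trans cn; rewrite -!size_filter.
have -> : [seq u0 <- s | u0 <= u - T] =
          [seq u0 <- [seq v <- s | v <= t] | u0 <= u - T].
  rewrite -filter_predI; apply: eq_filter => v /=.
  by case: (lerP v (u - T)) => //= vu; rewrite (le_trans vu)// (le_trans _ ut)// gerBl ltW.
rewrite [X in (X < _)%N]size_filter.
rewrite -(count_predC (fun v => v <= u - T) [seq v <- s | v <= t]) -addn1.
rewrite leq_add2l -has_count; apply/hasP; exists u; first by rewrite mem_filter ut.
by rewrite /= -ltNge ltrBlDr ltrDl.
Qed.

(** The last segment starts at [m], the largest of [0] and the jump times, and [m < l]. Hence the
    final flow time is positive, which [reach] does not record. *)
Lemma goes_from_to_reach eps l gamma x y : pseudo_orbit psi T eps l gamma ->
  goes_from_to l gamma x y ->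
  exists s z, [/\ 0 < s, reach eps x z & y = psi s z].
Proof.
move=> po [<- gy]; have := po.
move=> [l0 [rc [Delta [[finD DT] sep co fl jump]]]].
have /finite_seqP[s DE] := finD.
have [|m ms mmax] := @seq_has_max _ (0 :: s) _; first by [].
have m0 : 0 <= m by apply: mmax; rewrite mem_head.
have ml : m < l.
  move: ms; rewrite inE => /predU1P[->//|ms].
  by have /andP[] : T <= m < l by apply: DT; rewrite DE.
exists (l - m), (gamma m); split; first by rewrite subr_gt0.
  by apply: pseudo_orbit_reach po _; rewrite m0.
apply: (cvg_unique _ (F := gamma s @[s --> l^'-])) => //=.
  exact: metric_hausdorff.
apply: (@jump_free_limit l gamma Delta rc co fl m l m0 ml (lexx _)).
move=> u; rewrite DE /= => us mu _.
by have := mmax u; rewrite inE us orbT leNgt mu => /(_ isT).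
Qed.

(* [Delta] records genuine jumps only, so that continuity of [gamma] on an
   interval already excludes jump times from it. *)
Definition tailed_orbit (eps l s : R) (gamma : R -> N) (Delta : set R) : Prop :=
  [/\ 0 < s <= l, finite_set Delta /\ (forall u, Delta u -> T <= u <= l - s),
      forall u v, Delta u -> Delta v -> u != v -> T <= `|u - v|,
      forall a b, 0 <= a -> a <= b -> b < l ->
        (forall u, Delta u -> a < u -> u <= b -> False) ->
        gamma b = psi (b - a) (gamma a) &
      forall u, Delta u -> psi T (gamma (u - T)) <> gamma u /\
        mdist (psi T (gamma (u - T))) (gamma u) < eps].

Lemma tailed_orbit_shorten eps l s t gamma Delta : 0 <= t -> 0 < s ->
  tailed_orbit eps l (s + t) gamma Delta ->
  tailed_orbit eps l s gamma Delta /\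
  gamma (l - s) = psi t (gamma (l - (s + t))).
Proof.
move=> t0 s0 [/andP[st0 stl] [finD DT] sep fl jump]; split.
  split=> //; first by rewrite s0 (le_trans _ stl)// lerDl.
  by split=> // u /DT /andP[-> ul]; rewrite (le_trans ul)// lerB// lerDl.
rewrite (fl (l - (s + t)) (l - s)); first by congr psi; lra.
- by rewrite subr_ge0.
- lra.
- lra.
- by move=> u /DT /andP[_]; rewrite leNgt => /negP.
Qed.

(** The tail length [s] stays arbitrary in the induction: a flow step of time [t] asks for a tail
    [s + t], and a jump asks for a tail [T], whose end becomes the new jump time. *)
Lemma reach_tailed_orbit eps x y : reach eps x y -> forall s, 0 < s ->
  exists l gamma Delta,
    [/\ tailed_orbit eps l s gamma Delta, gamma 0 = x & gamma (l - s) = y].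
Proof.
elim=> [|t z t0 _ IH|z w _ IH zw] s s0.
- exists s, (fun t => psi t x), set0; split; last 2 first.
  + exact: flow0.
  + by rewrite subrr flow0.
  split=> //; first by rewrite s0 lexx.
  by move=> a b *; rewrite -flowD subrK.
- have [|l [gamma [Delta [to g0 gl]]]] := IH (s + t); first by lra.
  exists l, gamma, Delta; have [to' ->] := tailed_orbit_shorten t0 s0 to.
  by rewrite gl.
(* A jump of size zero is absorbed into the flow, since [Delta] may contain genuine jumps only. *)
- have [zwE|zwN] := pselect (psi T z = w).
    have [|l [gamma [Delta [to g0 gl]]]] := IH (s + T); first by rewrite addr_gt0.
    exists l, gamma, Delta; have [to' ->] := tailed_orbit_shorten (ltW T0) s0 to.
    by rewrite gl.
  have [l [gamma [Delta [[/andP[_ Tl] [finD DT] sep fl jump] g0 gl]]]] := IH T T0.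
  have l0 : 0 < l by exact: lt_le_trans Tl.
  have lTl : l - T < l by rewrite gtrBl.
  exists (l + s), (fun u => if u < l then gamma u else psi (u - l) w), (l |` Delta).
  split; last 2 first.
  + by rewrite l0.
  + by rewrite addrK ltxx subrr flow0.
  split; [|split| | |].
  + by rewrite s0 lerDr ltW.
  + by rewrite finite_setU; split=> //; exact: finite_set1.
  + move=> u [->|/DT/andP[-> ul]]; first by rewrite Tl addrK lexx.
    by rewrite addrK /= (le_trans ul)// ltW.
  + move=> u v [->|Du] [->|Dv]; rewrite ?eqxx// => uv.
    * by rewrite ger0_norm; have := DT _ Dv; lra.
    * by rewrite distrC ger0_norm; have := DT _ Du; lra.
    * exact: sep.
  + move=> a b a0 ab bls free; case: (ltP b l) => bl.
      rewrite (le_lt_trans ab bl); apply: fl => // u Du; apply: free.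
      by right.
    case: (ltP a l) => al; last by rewrite -flowD; congr psi; lra.
    by exfalso; apply: (free l) => //; left.
  + move=> u [->|Du]; first by rewrite lTl ltxx subrr flow0 gl.
    have /andP[Tu ul] := DT _ Du.
    have ul' : u < l by exact: le_lt_trans lTl.
    have -> : u - T < l by rewrite ltrBlDr (lt_trans ul')// ltrDl.
    by rewrite ul'; exact: jump.
Qed.

Lemma tailed_orbit_pseudo_orbit eps l s gamma Delta :
  tailed_orbit eps l s gamma Delta ->
  pseudo_orbit psi T eps l gamma /\
  gamma u @[u --> l^'-] --> psi s (gamma (l - s)).
Proof.
move=> [/andP[s0 sl] [finD DT] sep fl jump].
have l0 : 0 < l by exact: lt_le_trans sl.
have T0' := T0.
have D0 u : Delta u -> 0 < u < l by move=> /DT; lra.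
have gap t : exists2 e, 0 < e &
    forall u, Delta u -> t - e < u -> u < t + e -> u = t.
  have cD : closed (Delta `\` [set t]).
    move/accessible_finite_set_closed: (hausdorff_accessible (@Rhausdorff R)).
    by apply; exact: finite_setD.
  have : open (~` (Delta `\` [set t])) by exact: closed_openC.
  rewrite openE => /(_ t) []; first by move=> [_]; exact.
  move=> e /= e0 H; exists e => // u Du tu ut; apply: contrapT => nut.
  by apply: (H u) => //; rewrite /ball/= ltr_norml; lra.
have left_limit a b : 0 <= a -> a < b -> b <= l ->
    (forall u, Delta u -> a < u -> u < b -> False) ->
    gamma u @[u --> b^'-] --> psi (b - a) (gamma a).
  move=> a0 ab bl free; apply: flow_segment_limit => // v av vb.
  apply: fl => //; first exact: lt_le_trans bl.
  by move=> u Du au uv; apply: free Du au _; exact: le_lt_trans vb.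
have right_limit a : 0 <= a -> a < l -> gamma u @[u --> a^'+] --> gamma a.
  move=> a0 al.
  have H : (psi (s - a) (gamma a)) @[s --> a^'+] --> gamma a.
    apply: cvg_at_right_filter; rewrite -[X in _ --> X]flow0 -(subrr a).
    exact: flow_from_continuous.
  apply: cvg_trans H; apply: near_eq_cvg.
  have [e e0 ge] := gap a.
  apply/near_rightP; exists (Num.min e (l - a)); first by rewrite lt_min e0 subr_gt0.
  move=> v av; rewrite -ltrBlDl lt_min => /andP[ve vl].
  apply/esym/fl => //; [lra|lra|].
  by move=> u Du au uv; have ua := ge u Du; have := au; rewrite ua ?ltxx//; lra.
have jump_limit u : Delta u -> gamma v @[v --> u^'-] --> psi T (gamma (u - T)).
  move=> Du; have := DT _ Du => uT.
  rewrite -[X in psi X _](_ : u - (u - T) = T); last by lra.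
  apply: left_limit; [lra|lra|lra|].
  move=> v Dv uv vu; have /eqP/eqP := lt_eqF vu.
  by move=> vnu; have := sep _ _ Dv Du vnu; rewrite distrC ger0_norm; lra.
split; last first.
  rewrite -[X in psi X _](_ : l - (l - s) = s); last by lra.
  by apply: left_limit; [lra|lra|lra|move=> u /DT; lra].
split=> //; split; first by move=> t /andP[]; exact: right_limit.
exists Delta; split=> //.
- by split=> // u /DT; lra.
- move=> t /andP[t0 tl] nDt; apply/left_right_continuousP; split; last first.
    by apply: right_limit => //; exact: ltW.
  have [e e0 ge] := gap t.
  pose a := Num.max 0 (t - e).
  have a0 : 0 <= a by rewrite le_max lexx.
  have at_ : a < t by rewrite gt_max t0 ltrBlDr ltrDl.
  have free u : Delta u -> a < u -> u <= t -> False.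
    move=> Du au ut; apply: nDt; rewrite -(ge u Du)//.
      by rewrite (le_lt_trans _ au)// le_max lexx orbT.
    by rewrite (le_lt_trans ut)// ltrDl.
  rewrite (fl a t) ?(ltW at_)//; apply: left_limit => //; first exact: ltW.
  by move=> u Du au ut; exact: free Du au (ltW ut).
(* A jump time [v] inside the interval of continuity would force the left limit
   [psi T (gamma (v - T))] to equal [gamma v], against genuineness. *)
- move=> t u t0 tu ul ctu; apply: fl => // v Dv tv vu.
  have [neq _] := jump v Dv; apply: neq.
  apply: (cvg_unique _ (F := gamma s @[s --> v^'-])) => //=.
  + exact: metric_hausdorff.
  + exact: jump_limit.
  have /subspace_continuousP/(_ v) := ctu.
  rewrite /= in_itv/= (ltW tv) vu => /(_ isT) cv W /cv /near_normP[e e0 H].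
  apply/near_leftP; exists (Num.min e (v - t)); first by rewrite lt_min e0 subr_gt0.
  move=> w vw wv.
  have : v - w < Num.min e (v - t) by lra.
  rewrite lt_min => /andP[we wt].
  by apply: H; rewrite ?ger0_norm/= ?in_itv/=; lra.
- move=> u Du; exists (psi T (gamma (u - T))); first exact: jump_limit.
  by rewrite metric_sym; case: (jump u Du).
Qed.

Lemma reach_pseudo_orbit eps x y s : reach eps x y -> 0 < s ->
  exists l gamma, [/\ pseudo_orbit psi T eps l gamma, s <= l, gamma 0 = x,
    gamma (l - s) = y & gamma u @[u --> l^'-] --> psi s y].
Proof.
move=> /reach_tailed_orbit H /H[l [gamma [Delta [to g0 gl]]]].
exists l, gamma; have [po lim] := tailed_orbit_pseudo_orbit to.
by split=> //; [case: to => /andP[]|rewrite -gl].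
Qed.

Lemma leads_to_reach x y eps : leads_to psi T x y -> 0 < eps -> reach eps x y.
Proof.
move=> xy /xy[l [gamma [po gft]]].
have [s [z [s0 xz ->]]] := goes_from_to_reach po gft.
by apply: reach_flow => //; exact: ltW.
Qed.

(** Since [reach eps x x] always holds by the trivial chain, recurrence is expressed by ending at
    [psi (- s) x] with [s > 0]. *)
Lemma recurrent_reach x eps : recurrent psi T x -> 0 < eps ->
  exists2 s, 0 < s & reach eps x (psi (- s) x).
Proof.
move=> xx /xx[l [gamma [po gft]]].
have [s [z [s0 xz xE]]] := goes_from_to_reach po gft.
by exists s => //; rewrite {2}xE flowK.
Qed.

Lemma leads_toP x y : (forall eps, 0 < eps ->
  exists2 s, 0 < s & reach eps x (psi (- s) y)) -> leads_to psi T x y.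
Proof.
move=> H eps /H[s s0 xy].
have [l [gamma [po sl g0 gs lim]]] := reach_pseudo_orbit xy s0.
exists l, gamma; split=> //; split=> //.
by rewrite flowNK in lim.
Qed.

Lemma reach_leads_to x y : recurrent psi T y ->
  (forall eps, 0 < eps -> reach eps x y) -> leads_to psi T x y.
Proof.
move=> ry xy; apply: leads_toP => eps eps0.
have [s s0 yy] := recurrent_reach ry eps0.
by exists s => //; exact: reach_trans (xy _ eps0) yy.
Qed.

End Chains.

(** * Cocompact isometric actions *)

Section RealValued.
Variable R : realType.

Lemma continuous_mdistP (N N' : metricType R) (f : N -> N') :
  continuous f <-> forall x e, 0 < e ->
    exists2 d, 0 < d & forall y, mdist x y < d -> mdist (f x) (f y) < e.
Proof.
split=> [cf x e e0|H x W].
  have : nbhs (f x) [set z | mdist (f x) z < e].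
    by apply/near_mdistP; exists e.
  by move/cf/near_mdistP.
move=> /near_mdistP[e e0 He]; have [d d0 Hd] := H x e e0.
by apply/near_mdistP; exists d => // y /Hd/He.
Qed.

Lemma continuous_mdist_normP (N : metricType R) (f : N -> R) :
  continuous f <-> forall x e, 0 < e ->
    exists2 d, 0 < d & forall y, mdist x y < d -> `|f x - f y| < e.
Proof.
split=> [cf x e e0|H x W].
  have : nbhs (f x) [set z | `|f x - z| < e].
    by apply/near_normP; exists e.
  by move/cf/near_mdistP.
move=> /near_normP[e e0 He]; have [d d0 Hd] := H x e e0.
by apply/near_mdistP; exists d => // y /Hd/He.
Qed.

Lemma mdist_continuous (N : metricType R) (c1 c2 : R -> N) :
  continuous c1 -> continuous c2 -> continuous (fun t => mdist (c1 t) (c2 t)).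
Proof.
move=> k1 k2 t W /near_normP[e e0 He].
have near_c c : continuous c -> \forall s \near t, mdist (c t : N) (c s) < e / 2.
  move=> kc; have : nbhs (c t) [set y | mdist (c t) y < e / 2].
    by apply/near_mdistP; exists (e / 2); rewrite ?divr_gt0.
  exact: kc.
have /near_normP[d1 d10 H1] := near_c _ k1.
have /near_normP[d2 d20 H2] := near_c _ k2.
apply/near_normP; exists (Num.min d1 d2); first by rewrite lt_min d10.
move=> s; rewrite lt_min => /andP[/H1 h1 /H2 h2]; apply: He.
have := metric_triangle (c1 t) (c1 s) (c2 t).
have := metric_triangle (c1 s) (c2 s) (c2 t).
have := metric_triangle (c1 s) (c1 t) (c2 s).
have := metric_triangle (c1 t) (c2 t) (c2 s).
rewrite (metric_sym (c1 s) (c1 t)) (metric_sym (c2 s) (c2 t)) => *.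
by rewrite ltr_norml; apply/andP; split; lra.
Qed.

End RealValued.

Lemma compact_finite_cover (X : topologicalType) (A : set X) (U : X -> set X) :
  compact A -> (forall x, A x -> nbhs x (U x)) ->
  exists s : seq X, forall y, A y -> exists2 x, x \in s & U x y.
Proof.
move=> /compact_near_coveringP cA nU.
(* [F] is the filter of properties that hold for all sequences containing some given finite one; the
   near-covering form of compactness along it yields a single sequence. *)
pose F : set_system (seq X) := [set P | exists s : seq X,
  forall s' : seq X, {subset s <= s'} -> P s'].
have FF : Filter F.
  split; first by exists [::].
  - move=> P Q [s Ps] [s' Qs]; exists (s ++ s') => t st; split.
      by apply: Ps => x xs; apply: st; rewrite mem_cat xs.
    by apply: Qs => x xs; apply: st; rewrite mem_cat xs orbT.
  - by move=> P Q PQ [s Ps]; exists s => s' /Ps/PQ.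
have [] := cA _ F (fun (s : seq X) y => exists2 x, x \in s & U x y) FF.
  move=> x /nU nUx; exists (U x, [set s : seq X | x \in s]) => /=.
    by split=> //; exists [:: x] => s; apply; rewrite mem_seq1.
  by move=> [y s] [/= Uxy xs]; exists x.
by move=> s /(_ s (fun _ => id)) H; exists s.
Qed.

Section Cocompact.
Variables (R : realType) (E M : metricType R) (H : zmodType).
Variables (pi : E -> M) (act : H -> E -> E).
Hypothesis compactM : compact [set: M].
Hypothesis pi_open : forall x (U : set E), nbhs x U -> nbhs (pi x) (pi @` U).
Hypothesis pi_surj : forall m, exists x, pi x = m.
Hypothesis pi_fib : forall x y, pi x = pi y -> exists d, y = act d x.

(** Each local scale is valid over the image of a ball, a neighbourhood in [M]; invariance carries
    it along the whole fibre, and compactness of [M] gives a common scale. *)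
Lemma cocompact_uniform (Q : E -> R -> Prop) :
  (forall x, exists2 e, 0 < e & forall y s, mdist x y < e -> 0 < s < e -> Q y s) ->
  (forall d x s, Q x s -> Q (act d x) s) ->
  exists2 e, 0 < e & forall x s, 0 < s < e -> Q x s.
Proof.
move=> loc inv.
have /compact_near_coveringP cM := compactM.
have [] := cM R (0^'+) (fun s m => forall x, pi x = m -> Q x s) _ _.
  move=> m _; have [x xm] := pi_surj m; have [e e0 He] := loc x.
  exists (pi @` [set y | mdist x y < e], [set s | 0 < s < e]).
    split=> /=.
      by rewrite -xm; apply: pi_open; apply/near_mdistP; exists e.
    by apply/near_rightP; exists e => // s s0; rewrite add0r => se /=; apply/andP; split.
  move=> [_ s] [/= [y xy <-] s0e] z /esym/pi_fib[d ->].
  by apply: inv; exact: He.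
move=> e /= e0 He; exists e => // x s /andP[s0 se].
apply: (He s) => //=.
by rewrite sub0r normrN gtr0_norm.
Qed.

Hypothesis actG : group_action act.
Hypothesis act_iso : forall d x y, mdist (act d x) (act d y) = mdist x y.

Lemma actNK d : cancel (act (- d)) (act d).
Proof. by case: actG => act0 actD x; rewrite -actD subrr act0. Qed.

Lemma actK d : cancel (act d) (act (- d)).
Proof. by case: actG => act0 actD x; rewrite -actD addNr act0. Qed.

Lemma finite_net rho : 0 < rho -> exists s : seq E,
  forall x, exists2 p, p \in s & exists d, mdist x (act d p) < rho.
Proof.
move=> rho0; pose lift m := sval (cid (pi_surj m)).
have liftK m : pi (lift m) = m by rewrite /lift; case: cid.
have [m _|s cov] := compact_finite_cover
    (U := fun m => pi @` [set y | mdist (lift m) y < rho]) compactM.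
  by rewrite -{1}(liftK m); apply: pi_open; apply/near_mdistP; exists rho.
exists (map lift s) => x; have [//|m ms [y my /pi_fib[d ->]]] := cov (pi x).
exists (lift m); first exact: map_f.
by exists d; rewrite act_iso metric_sym.
Qed.

Lemma equivariant_uniform_continuous (a : H -> R) (h : E -> R) :
  continuous h -> (forall d x, h (act d x) = h x + a d) ->
  forall e, 0 < e ->
  exists2 rho, 0 < rho & forall x y, mdist x y < rho -> `|h x - h y| < e.
Proof.
move=> /continuous_mdist_normP ch hE e e0.
have [||r r0 Hr] := @cocompact_uniform
  (fun x s => forall y, mdist x y < s -> `|h x - h y| < e).
- move=> x; have [|d d0 Hd] := ch x (e / 2); first by rewrite divr_gt0.
  exists (d / 2); first by rewrite divr_gt0.
  move=> y s xy /andP[_ sd] z yz.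
  have yd := Hd y; have zd := Hd z.
  have := metric_triangle x y z.
  move=> xz; have {}yd : `|h x - h y| < e / 2 by apply: yd; lra.
  have {}zd : `|h x - h z| < e / 2 by apply: zd; lra.
  have -> : h y - h z = (h x - h z) - (h x - h y) by ring.
  by apply: (le_lt_trans (ler_normB _ _)); lra.
- move=> d x s Q y; rewrite -(actNK d y) act_iso (hE d x) (hE d (act _ y)) => /Q.
  by have -> : h x + a d - (h (act (- d) y) + a d) = h x - h (act (- d) y) by ring.
exists (r / 2); first by rewrite divr_gt0.
by move=> x y; apply: Hr; lra.
Qed.

End Cocompact.

(** * Perturbation of chains *)

Section ChainTransport.
Variables (R : realType) (N M : metricType R) (H : zmodType).
Variables (pi : N -> M) (act : H -> N -> N) (psi : R -> N -> N) (T : R).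
Hypothesis compactM : compact [set: M].
Hypothesis pi_open : forall x (U : set N), nbhs x U -> nbhs (pi x) (pi @` U).
Hypothesis pi_surj : forall m, exists x, pi x = m.
Hypothesis pi_fib : forall x y, pi x = pi y -> exists d, y = act d x.
Hypothesis actG : group_action act.
Hypothesis act_iso : forall d x y, mdist (act d x) (act d y) = mdist x y.
Hypothesis psiF : flow psi.
Hypothesis psi_act : forall t d x, psi t (act d x) = act d (psi t x).
Hypothesis T0 : 0 < T.

(** Compactness of the time interval gives a local modulus at each point, and [cocompact_uniform]
    makes it global, because the flow commutes with the isometries [act d]. *)
Lemma flow_uniform_continuous Tb e : 0 < e ->
  exists2 rho, 0 < rho & forall t x y, `|t| <= Tb -> mdist x y < rho ->
    mdist (psi t x) (psi t y) < e.
Proof.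
move=> e0.
have [||r r0 Hr] := @cocompact_uniform _ _ _ _ _ _ compactM pi_open pi_surj pi_fib
  (fun x s => forall t y, `|t| <= Tb -> mdist x y < s ->
    mdist (psi t x) (psi t y) < e).
- move=> x.
  have /compact_near_coveringP cK : compact `[- Tb, Tb] by exact: segment_compact.
  have : \forall y \near x, `[- Tb, Tb] `<=`
      (fun t => mdist (psi t x) (psi t y) < e / 2).
    apply: cK => t _; case: psiF => cont _ _.
    have nW : nbhs (psi t x) [set z | mdist (psi t x) z < e / 4].
      by apply/near_mdistP; exists (e / 4) => //; rewrite divr_gt0.
    have [[A B] /= [nA nB] AB] := cont (t, x) _ nW.
    exists (A, B) => // -[s y] [/= As By].
    have h1 := AB (s, y) (conj As By).
    have h2 := AB (s, x) (conj As (nbhs_singleton nB)).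
    have := metric_triangle (psi s x) (psi t x) (psi s y).
    by move: h1 h2; rewrite /= (metric_sym (psi s x) (psi t x)); lra.
  move=> /near_mdistP[d d0 Hd]; exists (d / 2); first by rewrite divr_gt0.
  have near_x t y : `|t| <= Tb -> mdist x y < d ->
      mdist (psi t x) (psi t y) < e / 2.
    move=> tT xy; apply: Hd => //.
    by rewrite /= in_itv/= -ler_norml.
  move=> y s xy /andP[_ sd] t z tT yz.
  have h1 := near_x t y tT; have h2 := near_x t z tT.
  have := metric_triangle x y z; move=> xz.
  have {}h1 : mdist (psi t x) (psi t y) < e / 2 by apply: h1; lra.
  have {}h2 : mdist (psi t x) (psi t z) < e / 2 by apply: h2; lra.
  have := metric_triangle (psi t y) (psi t x) (psi t z).
  by rewrite (metric_sym (psi t y) (psi t x)); lra.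
- move=> d x s Q t y tT; rewrite -(actNK actG d y) act_iso.
  rewrite (psi_act t d x) (psi_act t d (act _ y)) act_iso.
  exact: Q.
exists (r / 2); first by rewrite divr_gt0.
by move=> t x y; apply: Hr; lra.
Qed.

Lemma reach_act e d x y : reach psi T e x y -> reach psi T e (act d x) (act d y).
Proof.
elim=> [|t z t0 _ IH|z w _ IH zw]; first exact: reach_refl.
  by rewrite -psi_act; exact: reach_flow.
by apply: reach_jump IH _; rewrite psi_act act_iso.
Qed.

Lemma reach_shift s e : 0 < e -> exists2 e', 0 < e' &
  forall x y, reach psi T e' x y -> reach psi T e (psi s x) (psi s y).
Proof.
move=> e0; have [e' e'0 He] := flow_uniform_continuous `|s| e0.
exists e' => // x y; elim=> [|t z t0 _ IH|z w _ IH zw]; first exact: reach_refl.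
  by rewrite -(flowD psiF) addrC (flowD psiF); exact: reach_flow.
apply: reach_jump IH _.
by rewrite -(flowD psiF) addrC (flowD psiF); exact: He.
Qed.

(** Only the first jump feels the change of starting point, and its size grows by at most [tau]. A
    jump-free chain longer than [T] gets an artificial jump from [psi T x'] to [psi T x]; shorter
    ones are the exception in the statement. *)
Lemma reach_perturb_start tau : 0 < tau -> exists2 rho, 0 < rho &
  forall e x x' z, 0 <= e -> mdist x x' < rho -> reach psi T e x z ->
  (exists2 s, 0 <= s <= T & z = psi s x) \/ reach psi T (e + tau) x' z.
Proof.
move=> tau0; have [rho rho0 Hrho] := flow_uniform_continuous (T + T) tau0.
have T0' := T0.
exists rho => // e x x' z e0 xx'; elim=> [|t w t0 _ [[s s0T ->]|IH]|w w' _ IH ww'].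
- by left; exists 0; rewrite ?flow0 ?lexx ?ltW.
- case: (lerP (t + s) T) => tsT.
    by left; exists (t + s); [lra|rewrite (flowD psiF)].
  right; rewrite -(flowD psiF) -(subrK T (t + s)) (flowD psiF).
  apply: reach_flow; first by rewrite subr_ge0 ltW.
  apply: reach_jump (reach_refl _ _ _ _) _.
  rewrite metric_sym; have : mdist (psi T x) (psi T x') < tau.
    by apply: Hrho xx'; rewrite ger0_norm; lra.
  lra.
- by right; exact: reach_flow.
- right; case: IH => [[s s0T wE]|IH]; last first.
    by apply: reach_jump IH _; apply: (lt_trans ww'); rewrite ltrDl.
  apply: (@reach_jump _ _ _ _ _ _ (psi s x')).
    by apply: reach_flow; [case/andP: s0T|exact: reach_refl].
  have h : mdist (psi T w) (psi T (psi s x')) < tau.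
    by rewrite wE -!(flowD psiF); apply: Hrho xx'; rewrite ger0_norm; lra.
  have := metric_triangle (psi T (psi s x')) (psi T w) w'.
  by rewrite (metric_sym (psi T (psi s x')) (psi T w)); lra.
Qed.

(** Cuts a chain at its last jump with at most [T] of flow left. If more flow remains, a jump of
    size zero is inserted at the very end. *)
Lemma reach_last e a z : 0 < e -> reach psi T e a z ->
  (exists2 s, 0 <= s <= T & z = psi s a) \/
  exists s y y', [/\ 0 <= s <= T, reach psi T e a y,
                     mdist (psi T y) y' < e & z = psi s y'].
Proof.
have T0' := T0.
move=> e0; elim=> [|t w t0 _ IH|w w' aw _ ww'].
- by left; exists 0; rewrite ?flow0 ?lexx ?ltW.
- have [b [s [s0T wE ab]]] : exists b s, [/\ 0 <= s <= T, w = psi s b &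
      reach psi T e a b /\ (b = a \/ exists2 y, reach psi T e a y & mdist (psi T y) b < e)].
    case: IH => [[s s0T ->]|[s [y [y' [s0T ay yy' ->]]]]].
      by exists a, s; split=> //; split; [exact: reach_refl|left].
    exists y', s; split=> //; split; first exact: reach_jump ay yy'.
    by right; exists y.
  case: (lerP (t + s) T) => tsT.
    have tsE : psi t w = psi (t + s) b by rewrite wE (flowD psiF).
    case: ab => ab [ba|[y ay yb]]; [left|right].
      by exists (t + s); [lra|rewrite tsE ba].
    by exists (t + s), y, b; split=> //; lra.
  right; exists 0, (psi (t + s - T) b), (psi t w); split.
  + by rewrite lexx ltW.
  + by apply: reach_flow; [rewrite subr_ge0 ltW|case: ab].
  + by rewrite wE -!(flowD psiF) addrC subrK mdistxx.
  + by rewrite (flow0 psiF).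
- right; exists 0, w, w'; split=> //; first by rewrite lexx ltW.
  by rewrite (flow0 psiF).
Qed.

(** With [eta] half of [e], the last jump of an [eta]-chain ending very close to [b] could be
    redirected to make an [e]-chain ending at [b]. Chains without jump to redirect end on the
    compact arc [psi s a], [0 <= s <= T], which misses [b]. *)
Lemma unreachable_gap e : 0 < e -> exists2 eta, 0 < eta <= e &
  forall a b, ~ reach psi T e a b ->
  exists2 rho, 0 < rho & forall z, reach psi T eta a z -> rho <= mdist z b.
Proof.
move=> e0; have T0' := T0; exists (e / 2); first lra.
move=> a b nab.
have [|kap kap0 Hkap] := @flow_uniform_continuous T (e / 2); first lra.
have cc : continuous (fun s => mdist (psi s a) b).
  apply: mdist_continuous => [|t]; first exact: (flow_continuous_time psiF).
  exact: cvg_cst.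
have [c /[!in_itv]/= cT cmin] :=
  EVT_min (ltW T0) (@continuous_subspaceT _ _ `[0, T] _ cc).
have m0 : 0 < mdist (psi c a) b.
  rewrite mdist_gt0; apply/eqP => cb; apply: nab.
  by rewrite -cb; apply: reach_flow; [case/andP: cT|exact: reach_refl].
exists (Num.min kap (mdist (psi c a) b)); first by rewrite lt_min kap0.
move=> z az; rewrite leNgt lt_min; apply/negP => /andP[zb1 zb2].
have [|[s s0T zE]|[s [y [y' [s0T ay yy' zE]]]]] := reach_last _ az; first lra.
  by move: zb2; rewrite zE ltNge cmin// in_itv.
apply: nab; rewrite -(flowNK psiF s b); apply: reach_flow; first by case/andP: s0T.
apply: (@reach_jump _ _ _ _ _ _ y); first by apply: reach_le ay; lra.
have : mdist (psi (- s) z) (psi (- s) b) < e / 2.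
  by apply: Hkap => //; rewrite normrN ger0_norm; lra.
rewrite zE (flowK psiF).
have := metric_triangle (psi T y) y' (psi (- s) b); lra.
Qed.

(** The last jump of a chain from [y] back to its own orbit is redirected towards [y']; if it occurs
    more than [T] before the return to [y], a new jump is made at the end. Without any jump [y] is
    periodic, and going round long enough leaves the waiting time [T] before one jump. *)
Lemma recurrent_reach_near e : 0 < e -> exists2 rho, 0 < rho &
  forall y y', recurrent psi T y -> mdist y y' < rho -> reach psi T e y y'.
Proof.
move=> e0; have T0' := T0; have e20 : 0 < e / 2 by lra.
have [rho rho0 Hrho] := flow_uniform_continuous T e20.
exists (Num.min rho e); first by rewrite lt_min rho0.
move=> y y' ry; rewrite lt_min => /andP[yy1 yy2].
have [s s0 ys] := recurrent_reach psiF T0 ry e20.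
have [[t t0T E]|[t [u [w [t0T yu uw E]]]]] := reach_last e20 ys.
  have per : psi (s + t) y = y by rewrite (flowD psiF) -E (flowNK psiF).
  have pern n : psi (n%:R * (s + t)) y = y.
    elim: n => [|n IH]; first by rewrite mul0r (flow0 psiF).
    by rewrite -natr1 mulrDl mul1r (flowD psiF) per.
  have st0 : 0 < s + t by lra.
  pose n := (Num.truncn (T / (s + t))).+1.
  have Tn : T < n%:R * (s + t) by rewrite -ltr_pdivrMr// truncnS_gt.
  apply: (@reach_jump _ _ _ _ _ _ (psi (n%:R * (s + t) - T) y)).
    by apply: reach_flow; [rewrite subr_ge0 ltW|exact: reach_refl].
  by rewrite -(flowD psiF) addrC subrK pern.
have yE : y = psi (s + t) w by rewrite (flowD psiF) -E (flowNK psiF).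
have yu' : reach psi T e y u by apply: reach_le yu; lra.
case: (lerP (s + t) T) => stT.
  rewrite -(flowNK psiF (s + t) y'); apply: reach_flow; first lra.
  apply: (reach_jump yu').
  have : mdist (psi (- (s + t)) y) (psi (- (s + t)) y') < e / 2.
    by apply: Hrho => //; rewrite normrN ger0_norm; lra.
  rewrite {1}yE (flowK psiF).
  have := metric_triangle (psi T u) w (psi (- (s + t)) y'); lra.
apply: (@reach_jump _ _ _ _ _ _ (psi (s + t - T) w)).
  apply: reach_flow; first lra.
  by apply: (reach_jump yu'); lra.
by rewrite -(flowD psiF) addrC subrK -yE.
Qed.

End ChainTransport.

(** * Penalized suprema *)

Section PenalizedSup.
Variables (R : realType) (N M : metricType R) (H : zmodType).
Variables (pi : N -> M) (act : H -> N -> N) (psi : R -> N -> N) (T : R).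
Hypothesis compactM : compact [set: M].
Hypothesis pi_open : forall x (U : set N), nbhs x U -> nbhs (pi x) (pi @` U).
Hypothesis pi_surj : forall m, exists x, pi x = m.
Hypothesis pi_fib : forall x y, pi x = pi y -> exists d, y = act d x.
Hypothesis actG : group_action act.
Hypothesis act_iso : forall d x y, mdist (act d x) (act d y) = mdist x y.
Hypothesis psiF : flow psi.
Hypothesis psi_act : forall t d x, psi t (act d x) = act d (psi t x).
Hypothesis T0 : 0 < T.
Variables (alpha : {additive H -> R}) (g h : N -> R) (C L K eta : R).
Hypothesis g_bound : forall x z, reach psi T (3 * eta) x z -> g z <= g x + C.
Hypothesis h_unif : forall e, 0 < e ->
  exists2 rho, 0 < rho & forall x y, mdist x y < rho -> `|h x - h y| < e.
Hypothesis hE : forall d x, h (act d x) = h x + alpha d.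
Hypothesis h_lower : forall x, g x - L <= h x.
Hypothesis h_upper : forall x, h x <= g x.
Hypothesis eta0 : 0 < eta.
Hypothesis K0 : 0 <= K.
Hypothesis K_large : C + L <= K * eta.

(* The penalty makes the supremum continuous in [x]; it vanishes on jumps of
   size [eta], so [penalized_sup] decreases along [eta]-chains, and it exceeds
   any possible gain for jumps of size [2 * eta]. *)
Definition penalized_values (x : N) : set R :=
  [set y | exists e z, [/\ eta <= e <= 2 * eta, reach psi T e x z &
                           y = h z - K * (e - eta)]].

Definition penalized_sup (x : N) : R := sup (penalized_values x).

Let pen_ge0 e : eta <= e -> 0 <= K * (e - eta).
Proof. by move=> ee; rewrite mulr_ge0// subr_ge0. Qed.

Let value_le x : ubound (penalized_values x) (g x + C).
Proof.
have eta0' := eta0.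
move=> _ [e [z [/andP[e1 e2] xz ->]]]; have := pen_ge0 e1.
have := h_upper z; have : g z <= g x + C by apply: g_bound; apply: reach_le xz; lra.
lra.
Qed.

Lemma penalized_sup_ge x z : reach psi T eta x z -> h z <= penalized_sup x.
Proof.
have eta0' := eta0.
move=> xz; apply: ub_le_sup; first by exists (g x + C); exact: value_le.
by exists eta, z; rewrite subrr mulr0 subr0; split=> //; lra.
Qed.

Let value_nonempty x : penalized_values x !=set0.
Proof.
have eta0' := eta0.
exists (h x), eta, x; rewrite subrr mulr0 subr0; split=> //; first lra.
exact: reach_refl.
Qed.

Lemma penalized_sup_upper x B : (forall z, reach psi T (2 * eta) x z -> h z <= B) ->
  penalized_sup x <= B.
Proof.
move=> HB; apply: ge_sup => // _ [e [z [/andP[e1 e2] xz ->]]].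
by have := pen_ge0 e1; have := HB z (reach_le e2 xz); lra.
Qed.

Lemma penalized_sup_le x : penalized_sup x <= g x + C.
Proof. by apply: ge_sup => //; exact: value_le. Qed.

Lemma penalized_sup_decr x y : reach psi T eta x y ->
  penalized_sup y <= penalized_sup x.
Proof.
move=> xy; apply: ge_sup => // _ [e [z [/andP[e1 e2] yz ->]]].
apply: ub_le_sup; first by exists (g x + C); exact: value_le.
exists e, z; split=> //; first by rewrite e1.
by apply: reach_trans yz; exact: reach_le xy.
Qed.

Lemma penalized_sup_act d x :
  penalized_sup (act d x) = penalized_sup x + alpha d.
Proof.
have le_act d' x' : penalized_sup x' + alpha d' <= penalized_sup (act d' x').
  rewrite -lerBrDr; apply: ge_sup => // _ [e [z [e12 xz ->]]].
  rewrite lerBrDr; apply: ub_le_sup.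
    by exists (g (act d' x') + C); exact: value_le.
  exists e, (act d' z); split=> //; first exact: reach_act.
  by rewrite hE; lra.
apply/eqP; rewrite eq_le le_act andbT.
have := le_act (- d) (act d x); rewrite (actK actG) raddfN /=; lra.
Qed.

(** Moving the starting point turns a chain of size [e] into one of size [e + tau], at the cost
    [K * tau <= err / 2]. Chains with no usable jump are handled by uniform continuity of the flow
    and of [h]. *)
Lemma penalized_sup_continuous : continuous penalized_sup.
Proof.
have eta0' := eta0; have K0' := K0; have T0' := T0; have KL := K_large.
suff unif err : 0 < err -> exists2 rho, 0 < rho & forall x x', mdist x x' < rho ->
    penalized_sup x <= penalized_sup x' + err / 2.
  apply/continuous_mdist_normP => x err err0; have [rho rho0 Hrho] := unif _ err0.
  exists rho => // y xy; have := Hrho _ _ xy.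
  rewrite metric_sym in xy; have := Hrho _ _ xy.
  by rewrite ltr_norml => ? ?; apply/andP; split; lra.
move=> err0.
pose tau := Num.min eta (err / 2 / (K + 1)).
have tau0 : 0 < tau by rewrite lt_min eta0 !divr_gt0// ltr_wpDl.
have tau_eta : tau <= eta by rewrite ge_min lexx.
have Ktau : K * tau <= err / 2.
  have : (K + 1) * tau <= err / 2.
    by rewrite mulrC -ler_pdivlMr ?ltr_wpDl// ge_min lexx orbT.
  by rewrite mulrDl mul1r; lra.
have [rho1 rho10 H1] := reach_perturb_start compactM pi_open pi_surj pi_fib
  actG act_iso psiF psi_act T0 tau0.
have [|rhoh rhoh0 Hh] := @h_unif (err / 2); first lra.
have [rho2 rho20 H2] := flow_uniform_continuous compactM pi_open pi_surj pi_fib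
  actG act_iso psiF psi_act T rhoh0.
exists (Num.min rho1 rho2); first by rewrite lt_min rho10.
move=> x x'; rewrite lt_min => /andP[xx1 xx2].
apply: ge_sup => // _ [e [z [/andP[e1 e2] xz ->]]]; have pen := pen_ge0 e1.
have [|[s s0T zE]|x'z] := H1 e x x' z _ xx1 xz; first lra.
  have : h (psi s x') <= penalized_sup x'.
    apply: penalized_sup_ge; apply: reach_flow; last exact: reach_refl.
    by case/andP: s0T.
  have : `|h z - h (psi s x')| < err / 2.
    by rewrite zE; apply: Hh; apply: H2 => //; rewrite ger0_norm; lra.
  by rewrite ltr_norml; lra.
case: (lerP (e + tau) (2 * eta)) => etau.
  have : h z - K * (e + tau - eta) <= penalized_sup x'.
    apply: ub_le_sup; first by exists (g x' + C); exact: value_le.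
    by exists (e + tau), z; split=> //; lra.
  by rewrite !mulrBr mulrDr; lra.
(* Now [e - eta > eta - tau], so the penalty is at least [C + L - K * tau] and [h x'] alone is good
   enough. The size [e + tau] is at most [3 * eta], the range of [g_bound]. *)
have : g z <= g x' + C by apply: g_bound; apply: reach_le x'z; lra.
have := h_upper z; have := h_lower x'.
have : h x' <= penalized_sup x' by apply: penalized_sup_ge; exact: reach_refl.
have : K * (eta - tau) <= K * (e - eta) by apply: ler_wpM2l => //; lra.
by rewrite !mulrBr; lra.
Qed.

End PenalizedSup.

(** * Sums over finite sets and separating weights *)

Section FiniteSets.
Variable R : realType.

Lemma positive_below_finite (S : set R) c : finite_set S -> 0 < c ->
  exists2 w, 0 < w < c & forall s, S s -> 0 < s -> w < s.
Proof.
move=> /finite_seqP[l ->] c0.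
elim: l => [|a l [w /andP[w0 wc] Hw]]; first by exists (c / 2); [lra|].
have [a0|a0] := lerP a 0.
  exists w; first by rewrite w0.
  by move=> s; rewrite /= inE => /orP[/eqP->|]; [lra|exact: Hw].
exists (Num.min w (a / 2)).
  by rewrite lt_min w0 gt_min wc divr_gt0.
move=> s; rewrite /= inE => /orP[/eqP-> _|sl s0].
  by rewrite gt_min; apply/orP; right; lra.
by rewrite gt_min Hw.
Qed.

Lemma subsingleton_finite (X : Type) (A : set X) :
  (forall a b, A a -> A b -> a = b) -> finite_set A.
Proof.
move=> A1; have [[a Aa]|nA] := pselect (exists a, A a).
  by apply: (@sub_finite_set _ _ [set a]) (finite_set1 a) => b Ab; exact: A1.
by apply: (@sub_finite_set _ _ set0) => // a Aa; apply: nA; exists a.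
Qed.

Fixpoint sums (F : set R) (k : nat) : set R :=
  if k is k'.+1 then [set x | exists a f, [/\ sums F k' a, F f & x = a + f]]
  else [set 0].

Lemma sums_finite F k : finite_set F -> finite_set (sums F k).
Proof.
move=> finF; elim: k => [|k IH] /=; first exact: finite_set1.
apply: (@sub_finite_set _ _ [set a + f | a in sums F k & f in F]).
  by move=> _ [a [f [ka Ff ->]]]; exists a => //; exists f.
exact: finite_image2.
Qed.

(** A positive lower bound [c] of [F] limits the number of terms of such a sum to [B / c]. *)
Lemma bounded_sums_finite F B : finite_set F -> (forall f, F f -> 0 < f) ->
  finite_set [set x | (exists k, sums F k x) /\ x <= B].
Proof.
move=> finF F0; have [c /andP[c0 _] cF] := positive_below_finite finF ltr01.
have lower k x : sums F k x -> k%:R * c <= x.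
  elim: k x => [x ->|k IH _ [a [f [/IH ka Ff ->]]]]; first by rewrite mul0r.
  by rewrite -natr1 mulrDl mul1r lerD// ltW// cF// F0.
pose n := (Num.truncn (B / c)).+1.
apply: (@sub_finite_set _ _ (\bigcup_(k in `I_n) sums F k)); last first.
  by apply: bigcup_finite => // k _; exact: sums_finite.
move=> x [[k kx] xB]; exists k => //=; rewrite -(ltr_nat R).
apply: (@le_lt_trans _ _ (B / c)); last exact: truncnS_gt.
by rewrite ler_pdivlMr// (le_trans (lower _ _ kx)).
Qed.

End FiniteSets.

Section Weights.
Variables (R : realType) (X : Type) (d : nat -> X -> R) (b e : nat -> R).
Hypothesis b0 : forall i, 0 < b i.
Hypothesis d0_range : forall x, exists n, d 0%N x = e n.
Hypothesis d_finite : forall i c, finite_set (d i @` [set x | d 0%N x = c]).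
(* Since every [d i] recurs, each step deals with finitely many values [e k] only,
   hence has finitely many weights to avoid; later occurrences of [d i] deal with
   the remaining values. *)
Hypothesis d_again : forall i m, exists2 j, (m <= j)%N & d j = d i.

Let E m : set X := [set x | exists2 k, (k <= m)%N & d 0%N x = e k].

Let finite_on (P : X -> R) := forall c, finite_set (P @` [set x | d 0%N x = c]).

Let finite_on_E P m : finite_on P -> finite_set (P @` E m).
Proof.
move=> finP; apply: (@sub_finite_set _ _
  (\bigcup_(k in `I_m.+1) (P @` [set x | d 0%N x = e k]))); last first.
  by apply: bigcup_finite => // k _; exact: finP.
by move=> _ [x [k km xk] <-]; exists k => //; exists x.
Qed.

(** One choice of weight: [P] is the partial sum so far and [g] the gap to preserve. Staying below
    the positive elements of [S1] makes the new term at most [g / 2]; staying below those of [S2]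
    avoids every [w] cancelling [P x] against a nonzero [d m x]. *)
Let weight_step m (P : X -> R) (g : R) : finite_on P -> 0 < g ->
  exists w g', [/\ 0 < w <= b m, 0 < g' <= g / 2,
    forall x, E m x -> w * `|d m x| <= g / 2 &
    forall x, E m x -> (d m x != 0 -> P x + w * d m x != 0) /\
      (P x + w * d m x != 0 -> 2 * g' <= `|P x + w * d m x|)].
Proof.
move=> finP g0; have finA := finite_on_E m (d_finite m).
pose S1 := [set g / 2 / `|a| | a in d m @` E m].
pose S2 := [set - p / a | p in P @` E m & a in d m @` E m].
have finS : finite_set (S1 `|` S2).
  rewrite finite_setU; split; first exact: finite_image.
  by apply: finite_image2 => //; exact: finite_on_E.
have [w /andP[w0 wb] Hw] := positive_below_finite finS (b0 m).
have finP' : finite_on (fun x => P x + w * d m x).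
  move=> c; apply: (@sub_finite_set _ _ [set p + w * a |
      p in P @` [set x | d 0%N x = c] & a in d m @` [set x | d 0%N x = c]]).
    by move=> _ [x xc <-]; exists (P x); [exists x|exists (d m x); [exists x|]].
  by apply: finite_image2; [exact: finP|exact: d_finite].
have finS3 : finite_set [set `|q| / 2 | q in (fun x => P x + w * d m x) @` E m].
  by apply: finite_image; exact: finite_on_E.
have [|g' /andP[g'0 g'g] Hg'] := @positive_below_finite R _ (g / 2) finS3; first lra.
exists w, g'; split; first by rewrite w0 ltW.
- by rewrite g'0 ltW.
- move=> x Ex; have [->|dx] := eqVneq (d m x) 0; first by rewrite normr0 mulr0; lra.
  rewrite -ler_pdivlMr ?normr_gt0//; apply/ltW/Hw.
    by left; exists (d m x) => //; exists x.
  by rewrite !divr_gt0// normr_gt0.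
move=> x Ex; split=> [dx|Px].
  apply/negP => /eqP Pw; have wE : w = - P x / d m x.
    by apply: (mulIf dx); rewrite divfK//; lra.
  have := Hw w _ w0; rewrite ltxx => H; suff: false by [].
  apply: H; right; exists (P x); first by exists x.
  by exists (d m x) => //; exists x.
have := Hg' (`|P x + w * d m x| / 2); rewrite divr_gt0 ?normr_gt0// => H.
suff: g' < `|P x + w * d m x| / 2 by lra.
by apply: H => //; exists (P x + w * d m x) => //; exists x.
Qed.

Lemma separating_weights : exists w : nat -> R, (forall i, 0 < w i <= b i) /\
  forall x i, d i x != 0 -> exists2 c, 0 < c &
    exists m, forall n, (m <= n)%N -> c <= `|\sum_(0 <= j < n) w j * d j x|.
Proof.
(* A state holds the index, the partial sum, the current gap and the weight chosen last. *)
pose St := (nat * (X -> R) * R * R)%type.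
pose good (s : St) := finite_on s.1.1.2 /\ 0 < s.1.2.
pose rel (s s' : St) := let: (m, P, g, _) := s in let: (m', P', g', w) := s' in
  [/\ m' = m.+1, P' = (fun x => P x + w * d m x), 0 < w <= b m,
      0 < g' <= g / 2 &
      forall x, E m x -> [/\ w * `|d m x| <= g / 2,
        d m x != 0 -> P' x != 0 & P' x != 0 -> 2 * g' <= `|P' x|]].
have total s : good s -> exists2 s', rel s s' & good s'.
  move: s => [[[m P] g] w0] [/= finP g0].
  have [w [g' [w1 g1 H1 H2]]] := weight_step m finP g0.
  exists (m.+1, fun x => P x + w * d m x, g', w).
    by split=> // x Ex; have [h1 h2] := H2 x Ex; split=> //; exact: H1.
  split=> /=; last by case/andP: g1.
  move=> c; apply: (@sub_finite_set _ _ [set p + w * a |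
      p in P @` [set x | d 0%N x = c] & a in d m @` [set x | d 0%N x = c]]).
    by move=> _ [x xc <-]; exists (P x); [exists x|exists (d m x); [exists x|]].
  by apply: finite_image2; [exact: finP|exact: d_finite].
have good0 : good (0%N, fun=> 0, 1, 1).
  split=> //= c; apply: (@sub_finite_set _ _ [set 0]); last exact: finite_set1.
  by move=> _ [x _ <-].
pose next (s : {s | good s}) : {s | good s} :=
  let s' := cid2 (total _ (svalP s)) in exist good (s2val s') (s2valP' s').
have nextP s : rel (sval s) (sval (next s)) by exact: (s2valP (cid2 _)).
pose st n := iter n next (exist _ _ good0).
have stP n : rel (sval (st n)) (sval (st n.+1)) by exact: nextP.
have st_idx n : (sval (st n)).1.1.1 = n.
  elim: n => // n; have := stP n.
  case: (sval (st n)) (sval (st n.+1)) => [[[m P] g] w] [[[m' P'] g'] w'].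
  by move=> [-> _ _ _ _] /= ->.
pose P n := (sval (st n)).1.1.2; pose g n := (sval (st n)).1.2.
pose w n := (sval (st n.+1)).2.
have {}stP n : [/\ P n.+1 = (fun x => P n x + w n * d n x), 0 < w n <= b n,
    0 < g n.+1 <= g n / 2 &
    forall x, E n x -> [/\ w n * `|d n x| <= g n / 2,
      d n x != 0 -> P n.+1 x != 0 & P n.+1 x != 0 -> 2 * g n.+1 <= `|P n.+1 x|]].
  have := stP n; have := st_idx n; rewrite /P /g /w.
  case: (sval (st n)) (sval (st n.+1)) => [[[m Q] h] v] [[[m' Q'] h'] v'] /= ->.
  by case.
have g0 n : 0 < g n by rewrite /g; case: (svalP (st n)).
have PE n x : P n x = \sum_(0 <= j < n) w j * d j x.
  elim: n => [|n IH]; first by rewrite big_geq.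
  by rewrite big_nat_recr//= -IH; have [-> _ _ _] := stP n.
exists w; split=> [i|x i dix]; first by case: (stP i).
have [q xq] := d0_range x.
have [m qm dmE] := d_again i q.
have [_ _ _ /(_ x)[]] := stP m; first by exists q.
rewrite dmE => _ /(_ dix) Pm0 /(_ Pm0) Pm.
exists (g m.+1); first exact: g0.
exists m.+1 => n mn; rewrite -PE.
(* The partial sum is at least [2 * g m.+1] at stage [m.+1]. Each later term removes at most
   [g n / 2], while [g n.+1 <= g n / 2], so this bound propagates. *)
suff : g m.+1 + g n <= `|P n x| by have := g0 n; lra.
elim: n mn => // n IH; rewrite leq_eqVlt => /predU1P[[<-]|mn]; first lra.
have {}IH := IH mn; have [-> _ /andP[_ gn] /(_ x)[]] := stP n.
  by exists q => //; exact: (leq_trans qm (ltnW mn)).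
move=> wd _ _; have w0 : 0 < w n by case: (stP n) => _ /andP[].
have := lerB_dist (P n x) (- (w n * d n x)).
rewrite opprK normrN normrM (gtr0_norm w0); lra.
Qed.

End Weights.

(** * Heights reached by chains *)

Section FiniteHeights.
Variables (R : realType) (N M : metricType R) (H : zmodType).
Variables (pi : N -> M) (act : H -> N -> N) (psi : R -> N -> N) (T : R).
Hypothesis compactM : compact [set: M].
Hypothesis pi_open : forall x (U : set N), nbhs x U -> nbhs (pi x) (pi @` U).
Hypothesis pi_surj : forall m, exists x, pi x = m.
Hypothesis pi_fib : forall x y, pi x = pi y -> exists d, y = act d x.
Hypothesis actG : group_action act.
Hypothesis act_iso : forall d x y, mdist (act d x) (act d y) = mdist x y.
Hypothesis psiF : flow psi.
Hypothesis psi_act : forall t d x, psi t (act d x) = act d (psi t x).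
Hypothesis T0 : 0 < T.
Variables (alpha : {additive H -> R}) (r : R).
Hypothesis r0 : 0 < r.
Hypothesis alpha_sep : forall d x, mdist (act d x) x < r -> alpha d = 0.

Lemma act_mdistN d x y : mdist (act d x) y = mdist x (act (- d) y).
Proof. by rewrite -{1}(actNK actG d y) act_iso. Qed.

Lemma alpha_near d d' x : mdist (act d x) (act d' x) < r -> alpha d = alpha d'.
Proof.
rewrite metric_sym act_mdistN; case: actG => _ actD; rewrite -actD metric_sym.
by move=> /alpha_sep; rewrite (raddfD alpha) (raddfN alpha) /=; lra.
Qed.

(** Translates of [y] close to one point of the arc all have the same height by [alpha_near], and
    finitely many points approximate the arc. *)
Lemma heights_near_orbit_finite kap x y : 4 * kap <= r -> 0 < kap ->
  finite_set [set alpha d | d in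
    [set d | exists2 t, 0 <= t <= T + T & mdist (psi t x) (act d y) < kap]].
Proof.
move=> kr k0.
have [t _|s cov] := compact_finite_cover
    (U := fun t => [set t' | mdist (psi t x) (psi t' x) < kap])
    (@segment_compact R 0 (T + T)).
  have : nbhs (psi t x) [set z | mdist (psi t x) z < kap].
    by apply/near_mdistP; exists kap.
  by move/(flow_continuous_time psiF).
apply: (@sub_finite_set _ _ (\bigcup_(t in [set` s])
    [set alpha d | d in [set d | mdist (psi t x) (act d y) < 2 * kap]])).
  move=> _ [d [t t0T td] <-]; have [|t' t's /= tt'] := cov t; first by rewrite /= in_itv.
  exists t' => //; exists d => //=.
  have := metric_triangle (psi t' x) (psi t x) (act d y); lra.
apply: bigcup_finite => [|t _]; first by apply/finite_seqP; exists s.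
apply: subsingleton_finite => _ _ [d /= td <-] [d' /= td' <-].
apply: (@alpha_near _ _ y).
have := metric_triangle (act d y) (psi t x) (act d' y).
rewrite (metric_sym (act d y) (psi t x)); lra.
Qed.

Variables (u : N -> R) (eps : R).
Hypothesis eps0 : 0 < eps.
Hypothesis uE : forall d x, u (act d x) = u x + alpha d.
Hypothesis u_decr : forall x y, reach psi T eps x y -> u y <= u x.

(* Chains are snapped to the orbit of a finite net.  Along a snapped chain [u]
   drops by elements of a finite set of nonnegative reals; a bounded total drop
   therefore takes finitely many values, and [u] recovers the height. *)
Lemma finite_heights : exists2 eta, 0 < eta & forall a b (B : R),
  finite_set [set alpha d | d in
    [set d | B <= alpha d /\
       exists2 z, reach psi T eta a z & mdist z (act d b) < eta]].
Proof.
have T0' := T0; have r0' := r0; have eps0' := eps0.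
(* A snapped jump is smaller than [3 * eta]: it must be an [eps]-jump, and
   [heights_near_orbit_finite] is used with [kap = 3 * eta]. *)
pose eta := Num.min (eps / 3) (r / 12).
have eta_gt0 : 0 < eta by rewrite lt_min !divr_gt0.
have eta_eps : 3 * eta <= eps.
  by rewrite mulrC -ler_pdivlMr// ge_min lexx.
have eta_r : 12 * eta <= r.
  by rewrite mulrC -ler_pdivlMr// ge_min lexx orbT.
exists eta => // a b B.
have [rho' rho'0 Hrho'] := flow_uniform_continuous compactM pi_open pi_surj pi_fib
  actG act_iso psiF psi_act (T + T) eta_gt0.
pose rho := Num.min rho' eta.
have rho0 : 0 < rho by rewrite lt_min rho'0.
have rho_eta : rho <= eta by rewrite ge_min lexx orbT.
have Hrho t x y : 0 <= t <= T + T -> mdist x y < rho -> mdist (psi t x) (psi t y) < eta.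
  move=> t0; rewrite lt_min => /andP[xy _]; apply: Hrho' => //.
  by rewrite ger0_norm; lra.
have [s net] := finite_net compactM pi_open pi_surj pi_fib act_iso rho0.
(* Times go up to [T + T] because as much as [T] may have been flowed since the last snap when the
   waiting time [T] of the next jump begins. *)
pose near_heights p y := [set alpha d | d in
    [set d | exists2 t, 0 <= t <= T + T & mdist (psi t p) (act d y) < 3 * eta]].
have near_fin p y : finite_set (near_heights p y).
  by apply: heights_near_orbit_finite; lra.
pose D := [set f | exists p p' l, [/\ p \in s, p' \in s, near_heights p p' l,
                   f = u p - u p' - l & 0 < f]].
have finD : finite_set D.
  apply: (@sub_finite_set _ _ (\bigcup_(p in [set` s]) \bigcup_(p' in [set` s])
     [set u p - u p' - l | l in near_heights p p'])).
    move=> f [p [p' [l [ps p's pl fE _]]]].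
    by exists p => //; exists p' => //; exists l.
  apply: bigcup_finite => [|p _]; first by apply/finite_seqP; exists s.
  apply: bigcup_finite => [|p' _]; first by apply/finite_seqP; exists s.
  exact: finite_image.
have [p0 p0s [d0 ap0]] := net a.
pose w0 := act d0 p0.
pose good p d := p \in s /\ exists k, sums D k (u w0 - u (act d p)).
have good_step p d p' d' t : good p d -> p' \in s -> T <= t <= T + T ->
    mdist (psi t (act d p)) (act d' p') < 3 * eta -> good p' d'.
  move=> [ps [k kp]] p's tT dist; split=> //.
  have dec : u (act d' p') <= u (act d p).
    apply: u_decr; apply: (@reach_jump _ _ _ _ _ _ (psi (t - T) (act d p))).
      by apply: reach_flow; [lra|exact: reach_refl].
    by rewrite -(flowD psiF) addrC subrK; lra.
  move: dec; rewrite le_eqVlt => /predU1P[->|dec]; first by exists k.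
  exists k.+1, (u w0 - u (act d p)), (u (act d p) - u (act d' p')).
  split; [by []| |by rewrite addrA subrK].
  exists p, p', (alpha (- d + d')); split=> //; last by rewrite subr_gt0.
  - exists (- d + d') => //; exists t; first lra.
    by case: actG => _ actD; rewrite -(act_iso d) -psi_act actD (actNK actG).
  - by rewrite !uE (raddfD alpha) (raddfN alpha) /=; lra.
(* A long flow is cut into pieces of length [T], snapping again after each; the invariant keeps an
   unsnapped remainder [sg <= T]. *)
have flow_good n y p d t : good p d -> mdist y (act d p) < rho ->
    0 <= t -> t <= n.+1%:R * T -> exists sg y' p' d',
    [/\ 0 <= sg <= T, psi t y = psi sg y', good p' d' & mdist y' (act d' p') < rho].
  elim: n y p d t => [|n IH] y p d t pd yp t0 tn.
    by exists t, y, p, d; split=> //; lra.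
  case: (lerP t T) => tT; first by exists t, y, p, d; split=> //; lra.
  have [p' p's [d' yp']] := net (psi T y).
  have [||||sg [y' [p'' [d'' [sgT E gd yp'']]]]] := IH (psi T y) p' d' (t - T).
  - apply: (good_step p d p' d' T) => //; first lra.
    have : mdist (psi T y) (psi T (act d p)) < eta by apply: Hrho => //; lra.
    have := metric_triangle (psi T (act d p)) (psi T y) (act d' p').
    by rewrite (metric_sym (psi T (act d p)) (psi T y)); lra.
  - by [].
  - lra.
  - by move: tn; rewrite -[n.+2%:R]natr1 mulrDl mul1r; lra.
  - by exists sg, y', p'', d''; split=> //; rewrite -E -(flowD psiF) subrK.
have chain_good z : reach psi T eta a z -> exists sg y p d,
    [/\ 0 <= sg <= T, z = psi sg y, good p d & mdist y (act d p) < rho].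
  elim=> [|t z' t0 _ [sg [y [p [d [sgT -> pd yp]]]]]
         |z' w _ [sg [y [p [d [sgT -> pd yp]]]]] zw].
  - exists 0, a, p0, d0; split=> //; [lra|by rewrite (flow0 psiF)|].
    by split=> //; exists 0%N; rewrite /= subrr.
  - rewrite -(flowD psiF).
    apply: (flow_good (Num.truncn ((t + sg) / T)) y p d) => //; first lra.
    by rewrite -ler_pdivrMr// ltW// truncnS_gt.
  - have [p' p's [d' wp']] := net w.
    exists 0, w, p', d'; split=> //; [lra|by rewrite (flow0 psiF)|].
    apply: (good_step p d p' d' (T + sg)) => //; first lra.
    have : mdist (psi (T + sg) y) (psi (T + sg) (act d p)) < eta.
      by apply: Hrho => //; lra.
    rewrite -(flowD psiF) in zw.
    have := metric_triangle (psi (T + sg) (act d p)) (psi (T + sg) y) (act d' p').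
    have := metric_triangle (psi (T + sg) y) w (act d' p').
    by rewrite (metric_sym (psi (T + sg) (act d p)) (psi (T + sg) y)); lra.
(* If the snapped chain ends near [act d' p], with total drop [x] of [u], then
   [alpha d' = u w0 - u p - x], and [l = alpha (- d' + d)] takes finitely many values. The bound
   [B <= alpha d] bounds [x] from above. *)
apply: (@sub_finite_set _ _ (\bigcup_(p in [set` s])
    \bigcup_(l in near_heights p b) [set u w0 - u p - x + l | x in
      [set x | (exists k, sums D k x) /\ x <= u w0 - u p + l - B]])); last first.
  apply: bigcup_finite => [|p _]; first by apply/finite_seqP; exists s.
  apply: bigcup_finite => // l _; apply: finite_image.
  by apply: bounded_sums_finite => // f [p1 [p2 [l1 []]]].
move=> _ [d [Bd [z az zd]] <-].
have [sg [y [p [d' [sgT zE [ps [k kp]] yp]]]]] := chain_good z az.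
exists p => //; exists (alpha (- d' + d)).
  exists (- d' + d) => //; exists sg; first lra.
  case: actG => _ actD; rewrite -(act_iso d') -psi_act actD (actNK actG).
  have : mdist (psi sg y) (psi sg (act d' p)) < eta by apply: Hrho => //; lra.
  have := metric_triangle (psi sg (act d' p)) (psi sg y) (act d b).
  by rewrite (metric_sym (psi sg (act d' p)) (psi sg y)) -zE; lra.
exists (u w0 - u (act d' p)); last by rewrite uE (raddfD alpha) (raddfN alpha) /=; lra.
by split; [exists k|rewrite uE (raddfD alpha) (raddfN alpha) /=; lra].
Qed.

End FiniteHeights.

(** * Equivariant functions and lifts *)

Section EquivariantFunctions.
Variables (R : realType) (N M : metricType R) (H : zmodType).
Variables (pi : N -> M) (act : H -> N -> N).
Hypothesis compactM : compact [set: M].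
Hypothesis pi_open : forall x (U : set N), nbhs x U -> nbhs (pi x) (pi @` U).
Hypothesis pi_surj : forall m, exists x, pi x = m.
Hypothesis pi_fib : forall x y, pi x = pi y -> exists d, y = act d x.
Hypothesis actG : group_action act.
Hypothesis act_iso : forall d x y, mdist (act d x) (act d y) = mdist x y.
Variables (alpha : {additive H -> R}) (r : R).
Hypothesis r0 : 0 < r.
Hypothesis alpha_sep : forall d x, mdist (act d x) x < r -> alpha d = 0.

(* Walking along a connected space through the orbit of a finite net, [alpha]
   changes by an element of a finite set at each step. *)
Lemma alpha_range_countable (x0 : N) : connected [set: N] ->
  countable (range alpha).
Proof.
move=> connN; have r0' := r0; pose rho := r / 6.
have rho0 : 0 < rho by rewrite divr_gt0.
have rho6 : rho *+ 6 = r by rewrite /rho -mulr_natr divfK.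
have [s net] := finite_net compactM pi_open pi_surj pi_fib act_iso rho0.
pose step p p' := [set alpha d | d in [set d | mdist (act d p) p' < 3 * rho]].
pose F := \bigcup_(p in [set` s]) \bigcup_(p' in [set` s]) step p p'.
have finF : finite_set F.
  apply: bigcup_finite => [|p _]; first by apply/finite_seqP; exists s.
  apply: bigcup_finite => [|p' _]; first by apply/finite_seqP; exists s.
  apply: subsingleton_finite => _ _ [d /= dp <-] [d' /= dp' <-].
  apply: (alpha_near actG act_iso alpha_sep (x := p)).
  have := metric_triangle (act d p) p' (act d' p).
  by rewrite (metric_sym p') ; lra.
pose A := \bigcup_k sums F k.
have AD a f : A a -> F f -> A (a + f) by move=> [k _ ka] Ff; exists k.+1 => //; exists a, f.
have stepF d d' p p' : p \in s -> p' \in s ->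
    mdist (act d p) (act d' p') < 3 * rho -> F (alpha d - alpha d').
  move=> ps p's dd; exists p => //; exists p' => //; exists (- d' + d).
    by case: actG => _ actD; rewrite /= -(act_iso d') actD (actNK actG).
  by rewrite (raddfD alpha) (raddfN alpha) addrC.
have [p0 p0s [d0 xp0]] := net x0.
(* [U] is open and closed: a point and its neighbours lie near translates of net points that differ
   by one [step], and [A] is stable under adding elements of [F]. *)
pose U := [set x | exists p d, [/\ p \in s, mdist x (act d p) < rho &
                                   A (alpha d - alpha d0)]].
have openU : open U.
  rewrite openE => x [p [d [ps xp Ad]]]; apply/near_mdistP.
  exists (rho - mdist x (act d p)); first by rewrite subr_gt0.
  move=> y xy; exists p, d; split=> //.
  have := metric_triangle y x (act d p); rewrite (metric_sym y x); lra.
have closedU : closed U.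
  rewrite -[U]setCK; apply: open_closedC; rewrite openE => x nUx.
  apply/near_mdistP; have [p ps [d xp]] := net x.
  exists (rho - mdist x (act d p)); first by rewrite subr_gt0.
  move=> y xy [p' [d' [p's yp' Ad']]]; apply: nUx; exists p, d; split=> //.
  have -> : alpha d - alpha d0 = (alpha d' - alpha d0) + (alpha d - alpha d') by ring.
  apply: (AD _ _ Ad'); apply: (stepF _ _ p p') => //.
  have := metric_triangle (act d p) x (act d' p').
  have := metric_triangle x y (act d' p').
  by rewrite (metric_sym (act d p) x); have := mdist_ge0 x (act d p); lra.
have UT : U = setT.
  apply: connN; first exists x0.
  - by exists p0, d0; rewrite subrr; split=> //; exists 0%N.
  - by exists U => //; rewrite setTI.
  - by exists U => //; rewrite setTI.
apply: (@sub_countable _ _ _ A); last first.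
  apply: bigcup_countable => // k _; apply: finite_set_countable.
  exact: sums_finite.
apply: subset_card_le => _ [d _ <-].
have [p [d' [ps dp Ad']]] : U (act d x0) by rewrite UT.
have -> : alpha d = (alpha d' - alpha d0) + (alpha (d + d0) - alpha d').
  by rewrite (raddfD alpha); ring.
apply: (AD _ _ Ad'); apply: (stepF _ _ p0 p) => //; case: actG => _ actD.
have := metric_triangle (act (d + d0) p0) (act d x0) (act d' p).
by rewrite {2}actD act_iso (metric_sym (act d0 p0)); lra.
Qed.

Hypothesis act_ker : forall d x, alpha d = 0 -> act d x = x.

Let bump (q x : N) : R := Num.max 0 (r / 4 - mdist x q).

Let bump_continuous q : continuous (bump q).
Proof.
apply/continuous_mdist_normP => x e e0; exists e => // y xy.
have := metric_triangle x y q; have := metric_triangle y x q.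
rewrite (metric_sym y x) /bump => h1 h2; rewrite ltr_norml !maxElt.
by case: ifP => c1; case: ifP => c2; apply/andP; split; lra.
Qed.

Let sheet p x := pselect (exists d, mdist x (act d p) < r / 2).

Let height p x : R := if sheet p x is left e then alpha (sval (cid e)) else 0.

Let weight p x : R :=
  if sheet p x is left e then bump (act (sval (cid e)) p) x else 0.

(** The translate of [p] picked by choice does not matter: two translates within [r / 2] of [x] have
    equal height, hence coincide by [act_ker]. *)
Let sheetE p d x : mdist x (act d p) < r / 2 ->
  height p x = alpha d /\ weight p x = bump (act d p) x.
Proof.
move=> xd; rewrite /height /weight; case: sheet => [e|[]]; last by exists d.
case: cid => d' /= xd'.
have ad : alpha d' = alpha d.
  apply: (alpha_near actG act_iso alpha_sep (x := p)).
  have := metric_triangle (act d' p) x (act d p).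
  by rewrite (metric_sym (act d' p) x); lra.
split=> //; congr (bump _ _); case: actG => _ actD.
have -> : d' = d + (d' - d) by rewrite addrC subrK.
rewrite actD (act_ker (d := d' - d))// (raddfD alpha) (raddfN alpha) ad.
by rewrite subrr.
Qed.

Let weight_far p x : (forall d, r / 4 <= mdist x (act d p)) -> weight p x = 0.
Proof.
move=> far; rewrite /weight; case: sheet => // e; case: cid => d /= _.
by rewrite /bump maxElt; case: ifP => //; have := far d; lra.
Qed.

(** [height p] need not be continuous, but its product with the weight is: the weight vanishes from
    distance [r / 4] on, well inside the radius [r / 2] on which the height is locally constant. *)
Let weight_continuous p : continuous (weight p) /\
  continuous (fun x => weight p x * height p x).
Proof.
have r0' := r0.
suff loc (x : N) : (exists2 d, \forall y \near x, weight p y = bump (act d p) y &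
      \forall y \near x, height p y = alpha d) \/
    (\forall y \near x, weight p y = 0).
  split=> x; have [[d wd hd]|w0] := loc x.
  - rewrite /continuous_at (nbhs_singleton wd).
    have bc := @bump_continuous (act d p) x; apply: cvg_trans bc.
    by apply: near_eq_cvg; apply: filterS wd => y ->.
  - rewrite /continuous_at (nbhs_singleton w0); apply: cvg_near_cst.
    by apply: filterS w0 => y ->.
  - rewrite /continuous_at (nbhs_singleton wd) (nbhs_singleton hd).
    have bc : (fun y => bump (act d p) y * alpha d) @ x --> bump (act d p) x * alpha d.
      by apply: cvgM; [exact: bump_continuous|exact: cvg_cst].
    apply: cvg_trans bc; apply: near_eq_cvg.
    by apply: filterS (filterI wd hd) => y [-> ->].
  - rewrite /continuous_at (nbhs_singleton w0) mul0r; apply: cvg_near_cst.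
    by apply: filterS w0 => y ->; rewrite mul0r.
have [[d xd]|far] := pselect (exists d, mdist x (act d p) < r / 2).
  left; exists d; apply/near_mdistP; exists (r / 2 - mdist x (act d p)).
  - by rewrite subr_gt0.
  - move=> y xy; apply: (sheetE _).2.
    by have := metric_triangle y x (act d p); rewrite (metric_sym y x); lra.
  - by rewrite subr_gt0.
  - move=> y xy; apply: (sheetE _).1.
    by have := metric_triangle y x (act d p); rewrite (metric_sym y x); lra.
right; apply/near_mdistP; exists (r / 8); first by rewrite divr_gt0.
move=> y xy; apply: weight_far => d.
have : r / 2 <= mdist x (act d p) by rewrite leNgt; apply/negP => xd; apply: far; exists d.
have := metric_triangle x y (act d p); lra.
Qed.

Let weight_act p d x : weight p (act d x) = weight p x /\
  weight p (act d x) * height p (act d x) = weight p x * (height p x + alpha d).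
Proof.
have r0' := r0; have [[e xe]|far] := pselect (exists e, mdist x (act e p) < r / 2).
  have de : mdist (act d x) (act (d + e) p) < r / 2.
    by case: actG => _ actD; rewrite actD act_iso.
  have [-> ->] := sheetE xe; have [-> ->] := sheetE de.
  case: actG => _ actD; rewrite /bump actD act_iso (raddfD alpha).
  by rewrite (addrC (alpha d)).
have w0 : weight p x = 0.
  apply: weight_far => e; rewrite leNgt; apply/negP => xe; apply: far; exists e; lra.
have -> : weight p (act d x) = 0.
  apply: weight_far => e; rewrite leNgt; apply/negP => xe; apply: far.
  exists (- d + e); case: actG => _ actD.
  by rewrite actD -(act_iso d) (actNK actG); lra.
by rewrite w0 !mul0r.
Qed.

(** Local heights are averaged with bump weights around the orbit of a finite net; the weights are
    invariant and each height shifts by [alpha d], so the average does too. *)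
Lemma equivariant_exists : exists2 g : N -> R,
  continuous g & forall d x, g (act d x) = g x + alpha d.
Proof.
have r0' := r0.
have [|s net] := @finite_net _ _ _ _ _ _ compactM pi_open pi_surj pi_fib act_iso (r / 4).
  by rewrite divr_gt0.
pose den x := \sum_(p <- s) weight p x.
pose num x := \sum_(p <- s) weight p x * height p x.
have weight_ge0 p x : 0 <= weight p x.
  by rewrite /weight; case: sheet => // e; rewrite le_max lexx.
have den0 x : den x != 0.
  have [p ps [d xp]] := net x; apply: lt0r_neq0.
  rewrite /den (big_rem p)//= ltr_pwDl//; last by apply: sumr_ge0.
  have [_ ->] : height p x = alpha d /\ weight p x = bump (act d p) x.
    by apply: sheetE; lra.
  by rewrite /bump lt_max; apply/orP; right; lra.
exists (fun x => num x / den x).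
  move=> x; apply: (@cvgM _ _ _ _ num (fun x => (den x)^-1)).
    apply: continuous_big => [|p _]; first exact: add_continuous.
    exact: (weight_continuous p).2.
  apply: (@cvgV _ _ _ _ den); first exact: den0.
  apply: continuous_big => [|p _]; first exact: add_continuous.
  exact: (weight_continuous p).1.
move=> d x; have -> : den (act d x) = den x.
  by apply: eq_bigr => p _; exact: (weight_act p d x).1.
have -> : num (act d x) = num x + den x * alpha d.
  rewrite /num /den mulr_suml -big_split; apply: eq_bigr => p _ /=.
  by rewrite (weight_act p d x).2 mulrDr.
by rewrite mulrDl (mulrC (den x)) mulfK.
Qed.

End EquivariantFunctions.

Section UniqueLifting.
Variables (R : realType) (N M : metricType R) (pi : N -> M) (r : R).
Hypothesis r0 : 0 < r.
Hypothesis pi_sep : forall x y, pi x = pi y -> mdist x y < r -> x = y.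

(** The distance between the two lifts is continuous and is either [0] or at least [r], so it cannot
    pass through [r / 2]. *)
Lemma unique_lifting (c1 c2 : R -> N) : continuous c1 -> continuous c2 ->
  (forall t, pi (c1 t) = pi (c2 t)) -> c1 0 = c2 0 -> c1 =1 c2.
Proof.
move=> k1 k2 picE c0 t; have r0' := r0.
pose D s := mdist (c1 s) (c2 s).
have D0 : D 0 = 0 by rewrite /D c0 mdistxx.
have Dc : continuous D by exact: mdist_continuous.
apply: contrapT => /eqP neq.
have Dt : r <= D t.
  by rewrite leNgt; apply/negP => /(pi_sep (picE t)) /eqP; rewrite (negbTE neq).
have [s Ds] : exists s, D s = r / 2.
  have [t0|t0] := lerP 0 t.
    have [||s _ <-] := @IVT _ D 0 t (r / 2) t0; last by exists s.
      exact: continuous_subspaceT.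
    by rewrite D0 ge_min le_max; apply/andP; split; apply/orP; [left|right]; lra.
  have [||s _ <-] := @IVT _ D t 0 (r / 2) (ltW t0); last by exists s.
    exact: continuous_subspaceT.
  by rewrite D0 ge_min le_max; apply/andP; split; apply/orP; [right|left]; lra.
have : D s = 0 by rewrite /D (pi_sep (picE s)) ?mdistxx// -/(D s) Ds; lra.
by rewrite Ds; lra.
Qed.

End UniqueLifting.

(** * A separating countable family *)

Section Separation.
Variables (R : realType) (N M : metricType R) (H : zmodType).
Variables (pi : N -> M) (act : H -> N -> N) (psi : R -> N -> N) (T : R).
Hypothesis compactM : compact [set: M].
Hypothesis pi_continuous : continuous pi.
Hypothesis pi_open : forall x (U : set N), nbhs x U -> nbhs (pi x) (pi @` U).
Hypothesis pi_surj : forall m, exists x, pi x = m.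
Hypothesis pi_fib : forall x y, pi x = pi y -> exists d, y = act d x.
Hypothesis pi_act : forall d x, pi (act d x) = pi x.
Hypothesis actG : group_action act.
Hypothesis act_iso : forall d x y, mdist (act d x) (act d y) = mdist x y.
Hypothesis psiF : flow psi.
Hypothesis psi_act : forall t d x, psi t (act d x) = act d (psi t x).
Hypothesis T0 : 0 < T.
Variables (alpha : {additive H -> R}) (r : R).
Hypothesis r0 : 0 < r.
Hypothesis alpha_sep : forall d x, mdist (act d x) x < r -> alpha d = 0.
Hypothesis act_ker : forall d x, alpha d = 0 -> act d x = x.
Variables (g : N -> R) (C eps0 : R).
Hypothesis g_continuous : continuous g.
Hypothesis gE : forall d x, g (act d x) = g x + alpha d.
Hypothesis eps0_gt0 : 0 < eps0.
Hypothesis g_bound : forall x z, reach psi T eps0 x z -> g z <= g x + C.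

Lemma compact_mdist_bounded (c : M) : exists2 B, 0 <= B & forall m, mdist m c <= B.
Proof.
have [m _|s cov] := compact_finite_cover
    (U := fun m => [set m' | mdist m m' < 1]) compactM.
  by apply/near_mdistP; exists 1.
have s0 : 0 <= \sum_(m <- s) mdist m c by apply: sumr_ge0 => m _; exact: mdist_ge0.
exists (\sum_(m <- s) mdist m c + 1); first lra.
move=> m; have [//|m' m's /= mm'] := cov m.
have : mdist m' c <= \sum_(m <- s) mdist m c.
  by rewrite (big_rem m')//= lerDl; apply: sumr_ge0 => ? _; exact: mdist_ge0.
have := metric_triangle m m' c; rewrite (metric_sym m m'); lra.
Qed.

Lemma compact_dense_sequence (m0 : M) : exists c : nat -> M,
  forall m e, 0 < e -> exists j, mdist m (c j) < e.
Proof.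
have /choice[s cov] n : exists s : seq M, forall m, exists2 m', m' \in s &
    mdist m' m < n.+1%:R^-1.
  have [m _|s cov] := compact_finite_cover
      (U := fun m => [set m' | mdist m m' < n.+1%:R^-1]) compactM.
    by apply/near_mdistP; exists n.+1%:R^-1.
  by exists s => m; exact: cov.
exists (fun j => let: (n, i) := odflt (0, 0)%N (choice.unpickle j) in nth m0 (s n) i).
move=> m e e0; pose n := Num.truncn e^-1.
have [m' m's mm'] := cov n m.
exists (choice.pickle (n, index m' (s n))); rewrite choice.pickleK /= nth_index//.
rewrite metric_sym; apply: (lt_trans mm').
by rewrite -[e]invrK ltf_pV2 ?posrE ?invr_gt0// truncnS_gt.
Qed.

Variable c : nat -> M.
Hypothesis c_dense : forall m e, 0 < e -> exists j, mdist m (c j) < e.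

Definition dist_bound (j : nat) : R := s2val (cid2 (compact_mdist_bounded (c j))).

Lemma dist_bound_ge0 j : 0 <= dist_bound j.
Proof. by rewrite /dist_bound; case: cid2. Qed.

Lemma dist_boundP j m : mdist m (c j) <= dist_bound j.
Proof. by rewrite /dist_bound; case: cid2. Qed.

(** For large [k] this cuts [g] down away from the fibre over [c j]. The correction factors through
    [M], which preserves equivariance. *)
Definition peak (k j : nat) (x : N) : R := g x - k%:R * mdist (pi x) (c j).

Definition scale (n : nat) : R := eps0 / 3 / n.+1%:R.

(** The rate is the smallest one allowed by [K_large], with [L = k%:R * dist_bound j] bounding how
    far [peak k j] lies below [g]. *)
Definition chain_value (k j n : nat) : N -> R :=
  penalized_sup psi T (peak k j) ((C + k%:R * dist_bound j) / scale n) (scale n).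

Lemma scale_gt0 n : 0 < scale n.
Proof. by rewrite !divr_gt0. Qed.

Lemma scale_le n : 3 * scale n <= eps0.
Proof.
rewrite mulrC -ler_pdivlMr// ler_pdivrMr// ler_peMr ?ler1n//.
by rewrite divr_ge0// ltW.
Qed.

Lemma C_ge0 (x : N) : 0 <= C.
Proof. by have := g_bound (reach_refl _ _ _ x); lra. Qed.

Lemma peak_act k j d x : peak k j (act d x) = peak k j x + alpha d.
Proof. by rewrite /peak gE pi_act; ring. Qed.

Lemma peak_unif k j e : 0 < e ->
  exists2 rho, 0 < rho & forall x y, mdist x y < rho -> `|peak k j x - peak k j y| < e.
Proof.
move=> e0; apply: (equivariant_uniform_continuous compactM pi_open pi_surj pi_fib
  actG act_iso _ (peak_act k j) e0).
move=> x; apply: cvgB; first exact: g_continuous.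
apply: cvgM; first exact: cvg_cst.
have dist_cont : continuous (fun m : M => mdist m (c j)).
  apply/continuous_mdist_normP => m d d0; exists d => // m' mm'.
  have := metric_triangle m m' (c j); have := metric_triangle m' m (c j).
  by rewrite (metric_sym m' m) ltr_norml => ? ?; apply/andP; split; lra.
by apply: (@continuous_comp _ _ _ pi (fun m : M => mdist m (c j)));
  [exact: pi_continuous|exact: dist_cont].
Qed.

Lemma peak_lower k j x : g x - k%:R * dist_bound j <= peak k j x.
Proof. by rewrite lerB// ler_wpM2l// dist_boundP. Qed.

Lemma peak_upper k j x : peak k j x <= g x.
Proof. by rewrite gerBl mulr_ge0// mdist_ge0. Qed.

Let g_bound_scale n x z : reach psi T (3 * scale n) x z -> g z <= g x + C.
Proof. by move=> xz; apply: g_bound; apply: reach_le xz; exact: scale_le. Qed.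

Let rate_ge0 (x : N) k j n : 0 <= (C + k%:R * dist_bound j) / scale n.
Proof.
rewrite divr_ge0 ?(ltW (scale_gt0 n))// addr_ge0 ?(C_ge0 x)//.
by rewrite mulr_ge0// dist_bound_ge0.
Qed.

Let rate_large k j n :
  C + k%:R * dist_bound j <= (C + k%:R * dist_bound j) / scale n * scale n.
Proof. by rewrite divfK// gt_eqF// scale_gt0. Qed.

Lemma chain_value_continuous k j n : continuous (chain_value k j n).
Proof.
move=> x; exact: (penalized_sup_continuous compactM pi_open pi_surj pi_fib actG act_iso
  psiF psi_act T0 (@g_bound_scale n) (@peak_unif k j) (peak_lower k j)
  (peak_upper k j) (scale_gt0 n) (rate_ge0 x k j n) (rate_large k j n)).
Qed.

Lemma chain_value_act k j n d x :
  chain_value k j n (act d x) = chain_value k j n x + alpha d.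
Proof.
exact: (penalized_sup_act actG act_iso psi_act (@g_bound_scale n) (peak_act k j)
  (peak_upper k j) (scale_gt0 n) (rate_ge0 x k j n)).
Qed.

Lemma chain_value_decr k j n x y : reach psi T (scale n) x y ->
  chain_value k j n y <= chain_value k j n x.
Proof.
exact: (penalized_sup_decr (@g_bound_scale n) (peak_upper k j) (scale_gt0 n)
  (rate_ge0 x k j n)).
Qed.

Lemma chain_value_ge k j n x : peak k j x <= chain_value k j n x.
Proof.
apply: (penalized_sup_ge (@g_bound_scale n) (peak_upper k j) (scale_gt0 n)
  (rate_ge0 x k j n)).
exact: reach_refl.
Qed.

Lemma chain_value_le k j n x : chain_value k j n x <= g x + C.
Proof.
exact: (penalized_sup_le (@g_bound_scale n) (peak_upper k j) (scale_gt0 n)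
  (rate_ge0 x k j n)).
Qed.

(** If [b] is not reachable from [a], a sharp peak over a point close to [pi b] has a value at [b]
    exceeding the chain value at [a]. Chains from [a] ending near the fibre of [b] end near
    translates of [b] whose heights are negative and bounded away from [0]. *)
Lemma chain_value_separates a b :
  (forall k j n, chain_value k j n a = chain_value k j n b) ->
  forall e, 0 < e -> reach psi T e a b.
Proof.
move=> vab e e0; apply: contrapT => nab; have eps0' := eps0_gt0.
have [etaD etaD0 finD] := finite_heights compactM pi_open pi_surj pi_fib actG act_iso
  psiF psi_act T0 r0 alpha_sep (scale_gt0 0) (chain_value_act 0 0 0)
  (@chain_value_decr 0 0 0).
pose e1 := Num.min e (scale 0).
have e10 : 0 < e1 by rewrite lt_min e0 scale_gt0.
(* A translate of height [0] is [b] itself; reaching one of positive height would make some chain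
   value at [a] larger than at [b]. *)
have unreach d : 0 <= alpha d -> ~ reach psi T e1 a (act d b).
  rewrite le_eqVlt => /predU1P[/esym d0|d0] ad.
    by apply: nab; rewrite act_ker// in ad; apply: reach_le ad; rewrite ge_min lexx.
  have : chain_value 0 0 0 (act d b) <= chain_value 0 0 0 a.
    by apply: chain_value_decr; apply: reach_le ad; rewrite ge_min lexx orbT.
  by rewrite chain_value_act vab; lra.
have [eta2 /andP[eta20 _] gap] := unreachable_gap compactM pi_open pi_surj pi_fib actG
  act_iso psiF psi_act T0 e10.
pose D := [set alpha d | d in [set d | -1 <= alpha d /\
  exists2 z, reach psi T etaD a z & mdist z (act d b) < etaD]].
have {}finD : finite_set D by exact: finD.
(* One [rho] serves all heights of the finite set [D], since a translate of [b] is determined by its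
   height. *)
have [rho rho0 Hrho] : exists2 rho, 0 < rho & forall d, D (alpha d) ->
    0 <= alpha d -> forall z, reach psi T eta2 a z -> rho <= mdist z (act d b).
  move: finD => /finite_seqP[l ->]; elim: l => [|x l [rho rho0 IH]].
    by exists 1 => // d; rewrite /= in_nil.
  have [[d [dx d0]]|nx] := pselect (exists d, alpha d = x /\ 0 <= alpha d).
    have [rho1 rho10 H1] := gap _ _ (unreach _ d0).
    exists (Num.min rho rho1); first by rewrite lt_min rho0.
    move=> d'; rewrite /= inE => /orP[/eqP d'x d'0 z az|dl d'0 z az]; last first.
      by rewrite ge_min IH.
    suff -> : act d' b = act d b by rewrite ge_min H1// orbT.
    have -> : d' = d + (d' - d) by rewrite addrC subrK.
    case: actG => _ ->; rewrite (act_ker (d := d' - d))//.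
    by rewrite (raddfD alpha) (raddfN alpha) dx d'x subrr.
  exists rho => // d; rewrite /= inE => /orP[/eqP dx d0|dl d0 z az]; last exact: IH.
  by exfalso; apply: nx; exists d.
have [cc /andP[c0 c1] Hc] := @positive_below_finite R [set - x | x in D] 1
  (finite_image _ finD) ltr01.
have below d z : reach psi T etaD a z -> reach psi T eta2 a z ->
    mdist z (act d b) < Num.min rho etaD -> alpha d < - cc.
  rewrite lt_min => azD az2 /andP[zr zD].
  case: (ltP (alpha d) (-1)) => d1; first lra.
  have Dd : D (alpha d) by exists d => //; split=> //; exists z.
  case: (lerP 0 (alpha d)) => d0; first by have := Hrho d Dd d0 z az2; lra.
  by have := Hc (- alpha d); rewrite oppr_gt0 => H';
    have := H' (ex_intro2 _ _ _ Dd erefl) d0; lra.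
have [|rhog rhog0 Hg] := equivariant_uniform_continuous compactM pi_open pi_surj pi_fib
  actG act_iso g_continuous gE (e := cc / 2); first lra.
pose rho1 := Num.min (Num.min rho etaD) rhog.
have rho10 : 0 < rho1 by rewrite !lt_min rho0 etaD0.
have [s s0 Hs] : exists2 s, 0 < s & forall m, mdist (pi b) m < s ->
    exists2 y, mdist b y < rho1 & pi y = m.
  have : nbhs (pi b) (pi @` [set y | mdist b y < rho1]).
    by apply: pi_open; apply/near_mdistP; exists rho1.
  by move=> /near_mdistP[s s0 Hs]; exists s => // m /Hs[y]; exists y.
(* The slope is so steep that at distance [s / 2] from [c j] the loss exceeds the largest gain
   [g a + C - g b] by more than [1]. *)
pose k := (Num.truncn ((g a + C - g b + 1) * 2 / s)).+1.
have ks : g a + C - g b + 1 < k%:R * (s / 2).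
  by rewrite mulrA ltr_pdivlMr// -ltr_pdivrMr// truncnS_gt.
pose kap := Num.min (s / 2) (cc / 4 / k%:R).
have kap0 : 0 < kap by rewrite lt_min !divr_gt0.
have [j bj] := c_dense (pi b) kap0.
have kkap : k%:R * mdist (pi b) (c j) <= cc / 4.
  rewrite mulrC -ler_pdivlMr//; apply/ltW/(lt_le_trans bj).
  by rewrite ge_min lexx orbT.
have js : mdist (pi b) (c j) <= s / 2.
  by apply/ltW/(lt_le_trans bj); rewrite ge_min lexx.
pose eta := Num.min etaD eta2.
have eta0 : 0 < eta by rewrite lt_min etaD0.
(* Penalized chains have size up to [2 * scale n], which must not exceed [etaD] and [eta2]. *)
pose n := Num.truncn (2 * (eps0 / 3) / eta).
have n_eta : 2 * scale n <= eta.
  have : 2 * (eps0 / 3) / eta < n.+1%:R by exact: truncnS_gt.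
  rewrite ltr_pdivrMr// => /ltW nE.
  by rewrite /scale mulrA ler_pdivrMr// (mulrC eta).
have /= := chain_value_ge k j n b; rewrite -vab.
suff : chain_value k j n a <= g b - cc / 2 by rewrite /peak; lra.
apply: (penalized_sup_upper (scale_gt0 n) (rate_ge0 a k j n)) => z az.
have azD : reach psi T etaD a z.
  by apply: reach_le az; apply: (le_trans n_eta); rewrite ge_min lexx.
have az2 : reach psi T eta2 a z.
  by apply: reach_le az; apply: (le_trans n_eta); rewrite ge_min lexx orbT.
case: (ltP (mdist (pi b) (pi z)) s) => bz.
  have [y yb /pi_fib[d zE]] := Hs _ bz.
  have zd : mdist z (act d b) < rho1 by rewrite zE act_iso metric_sym.
  move: zd; rewrite lt_min => /andP[zd zg].
  have := below d z azD az2 zd; have := Hg _ _ zg; rewrite gE ltr_norml.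
  by have := peak_upper k j z; lra.
have gz : g z <= g a + C.
  by apply: g_bound; apply: reach_le az; have := scale_le n; have := scale_gt0 n; lra.
have : s / 2 <= mdist (pi z) (c j).
  have := metric_triangle (pi b) (c j) (pi z).
  by rewrite (metric_sym (pi z)); lra.
move=> /(ler_wpM2l (ler0n R k)); rewrite /peak; lra.
Qed.

End Separation.

(** * Weighted sums *)

Section WeightedSeries.
Variable R : realType.

Lemma half_powers_small (e : R) : 0 < e ->
  exists m, forall n, (m <= n)%N -> 2^-1 ^+ n < e.
Proof.
move=> e0; have : (GRing.exp (2^-1 : R)) @ \oo --> (0 : R).
  by apply: cvg_expr; rewrite ger0_norm ?invr_ge0//; lra.
move=> /cvgrPdist_lt/(_ e e0)[m _ H]; exists m => n mn.
by have := H n mn; rewrite sub0r normrN ger0_norm// exprn_ge0// invr_ge0.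
Qed.

Lemma dominated_series (a : nat -> R) c : (forall i, `|a i| <= c * 2^-1 ^+ i) ->
  exists S, forall n, `|S - \sum_(0 <= j < n) a j| <= 2 * c * 2^-1 ^+ n.
Proof.
move=> dom.
have tail n m : (n <= m)%N ->
    `|\sum_(0 <= j < m) a j - \sum_(0 <= j < n) a j|
    <= 2 * c * 2^-1 ^+ n - 2 * c * 2^-1 ^+ m.
  elim: m => [|m IH]; first by rewrite leqn0 => /eqP->; rewrite !subrr normr0.
  rewrite leq_eqVlt => /predU1P[->|nm]; first by rewrite !subrr normr0.
  rewrite big_nat_recr//=; have := IH nm; have := dom m.
  have := ler_normD (\sum_(0 <= j < m) a j - \sum_(0 <= j < n) a j) (a m).
  rewrite addrAC exprS; set x := 2^-1 ^+ m.
  have -> : 2 * c * (2^-1 * x) = c * x by field.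
  lra.
have c0 : 0 <= c by have := dom 0%N; rewrite expr0 mulr1; apply: le_trans.
have cv : cvgn (series a).
  apply: normed_cvg; apply: (@series_le_cvg _ _ (geometric c 2^-1)).
  - by move=> n; exact: normr_ge0.
  - by move=> n; rewrite /geometric /= mulr_ge0// exprn_ge0// invr_ge0.
  - by move=> n; exact: dom.
  - by apply: is_cvg_geometric_series; rewrite ger0_norm ?invr_ge0//; lra.
exists (limn (series a)) => n; apply/ler_addgt0Pr => e e0.
move/cvgrPdist_lt: cv => /(_ e e0)[m _ Hm].
pose k := maxn m n; have := Hm k (leq_maxl _ _).
have := tail n k (leq_maxr _ _).
have : 0 <= 2 * c * 2^-1 ^+ k by rewrite !mulr_ge0// exprn_ge0// invr_ge0.
have := ler_normD (limn (series a) - series a k)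
  (\sum_(0 <= j < k) a j - \sum_(0 <= j < n) a j).
rewrite [series a k]/series /= addrA subrK; lra.
Qed.

Variables (N : metricType R) (v : nat -> N -> R) (g : N -> R) (B w : nat -> R).
Hypothesis v_continuous : forall i, continuous (v i).
Hypothesis g_continuous : continuous g.
Hypothesis B0 : forall i, 0 <= B i.
Hypothesis v_bound : forall i x, `|v i x| <= `|g x| + B i.
Hypothesis w0 : forall i, 0 < w i.
Hypothesis wB : forall i, w i * (1 + B i) <= 2^-1 ^+ i.

(** The bound [|v i x| <= (|g x| + 1) * (1 + B i)] makes the series converge geometrically with a
    constant depending only on [|g x|], hence locally uniformly. [W] is the sum of the weights. *)
Lemma weighted_sum : exists (F : N -> R) (W : R),
  [/\ 0 < W, continuous F,
    forall x y a, (forall i, v i y = v i x + a) -> F y = F x + W * a,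
    forall x y, (forall i, v i y <= v i x) ->
      forall i, w i * (v i x - v i y) <= F x - F y &
    forall x y, F x = F y -> forall e, 0 < e -> exists m, forall n, (m <= n)%N ->
      `|\sum_(0 <= j < n) w j * (v j x - v j y)| < e].
Proof.
have /choice[F HF] x : exists S, forall n,
    `|S - \sum_(0 <= j < n) w j * v j x| <= 2 * (`|g x| + 1) * 2^-1 ^+ n.
  apply: dominated_series => i; rewrite normrM (gtr0_norm (w0 i)).
  apply: (@le_trans _ _ (w i * ((`|g x| + 1) * (1 + B i)))).
    apply: ler_wpM2l; first exact: ltW.
    by have := v_bound i x; have := mulr_ge0 (normr_ge0 (g x)) (B0 i); lra.
  rewrite mulrCA; apply: ler_wpM2l; last exact: wB.
  by rewrite addr_ge0.
have [W HW] : exists S, forall n, `|S - \sum_(0 <= j < n) w j| <= 2 * 1 * 2^-1 ^+ n.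
  apply: dominated_series => i; rewrite gtr0_norm// mul1r; apply: le_trans (wB i).
  by rewrite ler_peMr// ?lerDl// ltW.
have approx x e : 0 < e -> exists m, forall n, (m <= n)%N ->
    `|F x - \sum_(0 <= j < n) w j * v j x| < e.
  move=> e0; have D0 : 0 < 2 * (`|g x| + 1) by rewrite mulr_gt0// ltr_wpDl.
  have [m Hm] := half_powers_small (divr_gt0 e0 D0).
  exists m => n /Hm; rewrite ltr_pdivlMr// mulrC; exact: le_lt_trans.
have approxW e : 0 < e -> exists m, forall n, (m <= n)%N ->
    `|W - \sum_(0 <= j < n) w j| < e.
  move=> e0; have [|m Hm] := @half_powers_small (e / 2); first lra.
  by exists m => n /Hm; have := HW n; lra.
have mono x y : (forall i, v i y <= v i x) ->
    forall i, w i * (v i x - v i y) <= F x - F y.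
  move=> vyx i; apply/ler_addgt0Pr => e e0; have e20 : 0 < e / 2 by lra.
  have [m1 H1] := approx x _ e20; have [m2 H2] := approx y _ e20.
  pose n := maxn i.+1 (maxn m1 m2).
  have {}H1 : `|F x - \sum_(0 <= j < n) w j * v j x| < e / 2.
    by apply: H1; rewrite /n !leq_max leqnn orbT.
  have {}H2 : `|F y - \sum_(0 <= j < n) w j * v j y| < e / 2.
    by apply: H2; rewrite /n !leq_max leqnn !orbT.
  have : w i * (v i x - v i y) <=
      \sum_(0 <= j < n) w j * v j x - \sum_(0 <= j < n) w j * v j y.
    rewrite -sumrB (bigD1_seq i)/= ?iota_uniq//; last first.
      by rewrite mem_index_iota /= leq_max leqnn.
    rewrite mulrBr lerDl; apply: sumr_ge0 => j _.
    by rewrite -mulrBr mulr_ge0 ?subr_ge0// ltW.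
  by move: H1 H2; rewrite !ltr_norml; lra.
exists F, W; split=> //.
- have := HW 1%N; rewrite big_nat1 expr1.
  have [m Hm] := approxW (w 0%N) (w0 0%N).
  have := Hm m.+1 (leqnSn _); rewrite big_nat_recl//= ltr_norml.
  have : 0 <= \sum_(0 <= i < m) w i.+1 by apply: sumr_ge0 => j _; exact: ltW.
  lra.
- apply/continuous_mdist_normP => x e e0.
  have e40 : 0 < e / 4 by lra.
  have D0 : 0 < 2 * (`|g x| + 2) by rewrite mulr_gt0// ltr_wpDl.
  have [n Hn] := half_powers_small (divr_gt0 e40 D0).
  have {}Hn := Hn n (leqnn n); rewrite ltr_pdivlMr// mulrC in Hn.
  have sc : continuous (fun y => \sum_(0 <= j < n) w j * v j y).
    apply: continuous_big => [|j _]; first exact: add_continuous.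
    by move=> y; apply: cvgM; [exact: cvg_cst|exact: v_continuous].
  move/continuous_mdist_normP: sc => /(_ x _ e40)[d1 d10 H1].
  move/continuous_mdist_normP: g_continuous => /(_ x 1 ltr01)[d2 d20 H2].
  exists (Num.min d1 d2); first by rewrite lt_min d10.
  move=> y; rewrite lt_min => /andP[/H1 h1 /H2 h2].
  have gy : `|g y| <= `|g x| + 1.
    by have := lerB_dist (g y) (g x); rewrite distrC; lra.
  have p0 : 0 <= 2^-1 ^+ n :> R by rewrite exprn_ge0// invr_ge0.
  have b1 : 2 * (`|g x| + 1) * 2^-1 ^+ n <= 2 * (`|g x| + 2) * 2^-1 ^+ n.
    by apply: ler_wpM2r => //; lra.
  have b2 : 2 * (`|g y| + 1) * 2^-1 ^+ n <= 2 * (`|g x| + 2) * 2^-1 ^+ n.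
    by apply: ler_wpM2r => //; lra.
  have := le_trans (HF x n) b1; have := le_trans (HF y n) b2.
  by move: Hn h1; rewrite !ltr_norml !ler_norml; lra.
- move=> x y a vE; apply/eqP; rewrite -subr_eq0 -normr_le0.
  apply/ler_addgt0Pr => e e0; rewrite add0r; have e30 : 0 < e / 3 by lra.
  have [m1 H1] := approx x _ e30; have [m2 H2] := approx y _ e30.
  have a0 : 0 < e / 3 / (`|a| + 1) by rewrite divr_gt0// ltr_wpDl.
  have [m3 H3] := approxW _ a0; pose n := maxn m1 (maxn m2 m3).
  have {}H1 : `|F x - \sum_(0 <= j < n) w j * v j x| < e / 3.
    by apply: H1; rewrite leq_max leqnn.
  have {}H2 : `|F y - \sum_(0 <= j < n) w j * v j y| < e / 3.
    by apply: H2; rewrite /n !leq_max leqnn !orbT.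
  have {H3} : `|W - \sum_(0 <= j < n) w j| < e / 3 / (`|a| + 1).
    by apply: H3; rewrite /n !leq_max leqnn !orbT.
  rewrite ltr_pdivlMr ?ltr_wpDl// => H3.
  have {H3} : `|(W - \sum_(0 <= j < n) w j) * a| < e / 3.
    by rewrite normrM; have := normr_ge0 (W - \sum_(0 <= j < n) w j); lra.
  have : \sum_(0 <= j < n) w j * v j y =
      \sum_(0 <= j < n) w j * v j x + (\sum_(0 <= j < n) w j) * a.
    by rewrite mulr_suml -big_split; apply: eq_bigr => j _; rewrite vE mulrDr.
  move=> sE; rewrite sE in H2; move: H1 H2.
  by rewrite mulrBl !ltr_norml ler_norml; lra.
- move=> x y Fxy e e0; have e20 : 0 < e / 2 by lra.
  have [m1 H1] := approx x _ e20; have [m2 H2] := approx y _ e20.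
  exists (maxn m1 m2) => n; rewrite geq_max => /andP[/H1 h1 /H2 h2].
  under eq_bigr do rewrite mulrBr.
  by move: h1 h2; rewrite sumrB Fxy !ltr_norml; lra.
Qed.

End WeightedSeries.

Lemma countable_enumeration (R : realType) (V : set R) : countable V ->
  exists e : nat -> R, forall x, V x -> exists n, x = e n.
Proof.
move=> /countable_injP[f finj]; exists (fun n => xget 0 [set x | V x /\ f x = n]).
move=> x Vx; exists (f x); case: xgetP => [y _ [Vy fy]|/(_ x)[]//].
by apply: finj; rewrite ?inE.
Qed.

(** * Existence of an equivariant Lyapunov function *)

Section Existence.
Variables (R : realType) (N M : metricType R) (H : zmodType).
Variables (pi : N -> M) (act : H -> N -> N) (psi : R -> N -> N) (T : R).
Hypothesis compactM : compact [set: M].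
Hypothesis connectedN : connected [set: N].
Hypothesis pi_continuous : continuous pi.
Hypothesis pi_open : forall x (U : set N), nbhs x U -> nbhs (pi x) (pi @` U).
Hypothesis pi_surj : forall m, exists x, pi x = m.
Hypothesis pi_fib : forall x y, pi x = pi y -> exists d, y = act d x.
Hypothesis pi_act : forall d x, pi (act d x) = pi x.
Hypothesis actG : group_action act.
Hypothesis act_iso : forall d x y, mdist (act d x) (act d y) = mdist x y.
Hypothesis psiF : flow psi.
Hypothesis psi_act : forall t d x, psi t (act d x) = act d (psi t x).
Hypothesis T0 : 0 < T.
Variables (alpha : {additive H -> R}) (r : R).
Hypothesis r0 : 0 < r.
Hypothesis alpha_sep : forall d x, mdist (act d x) x < r -> alpha d = 0.
Hypothesis act_ker : forall d x, alpha d = 0 -> act d x = x.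
Variables (g : N -> R) (C eps0 : R).
Hypothesis g_continuous : continuous g.
Hypothesis gE : forall d x, g (act d x) = g x + alpha d.
Hypothesis eps0_gt0 : 0 < eps0.
Hypothesis g_bound : forall x z, reach psi T eps0 x z -> g z <= g x + C.

Lemma recurrent_act d x : recurrent psi T x -> recurrent psi T (act d x).
Proof.
move=> rx; apply: (leads_toP psiF T0) => eps e0.
have [s s0 xs] := recurrent_reach psiF T0 rx e0; exists s => //.
by rewrite psi_act; exact: reach_act.
Qed.

Lemma recurrent_representatives eta : 0 < eta -> exists s : seq N,
  forall x, recurrent psi T x -> exists2 p, p \in s & exists d,
    reach psi T eta x (act d p) /\ reach psi T eta (act d p) x.
Proof.
move=> eta0.
have [rho rho0 Hrho] := recurrent_reach_near compactM pi_open pi_surj pi_fib actG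
  act_iso psiF psi_act T0 eta0.
have [|s net] := @finite_net _ _ _ _ _ _ compactM pi_open pi_surj pi_fib act_iso (rho / 2).
  by rewrite divr_gt0.
(* Net points are replaced by nearby recurrent points when there are any, because
   [recurrent_reach_near] is applied from both ends. *)
pose rep p := if pselect (exists y, recurrent psi T y /\ mdist y p < rho / 2)
  is left e then sval (cid e) else p.
exists (map rep s) => x rx; have [p ps [d xp]] := net x.
exists (rep p); first exact: map_f.
exists d; rewrite /rep; case: pselect => [e|[]]; last first.
  exists (act (- d) x); split; first exact: recurrent_act.
  by rewrite (act_mdistN actG act_iso) opprK.
case: cid => y /= [ry yp]; have xy : mdist x (act d y) < rho.
  have := metric_triangle x (act d p) (act d y).
  by rewrite act_iso (metric_sym p y); lra.
split; first exact: Hrho xy.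
by apply: Hrho; [exact: recurrent_act|rewrite metric_sym].
Qed.

Theorem equivariant_lyapunov_exists :
  exists2 f : N -> R, lyapunov psi T f & forall d x, f (act d x) = f x + alpha d.
Proof.
have [[x0 _]|Nempty] := pselect (exists x : N, True); last first.
  exists (fun=> 0); last by move=> d x; exfalso; apply: Nempty; exists x.
  split.
  - by move=> x; exfalso; apply: Nempty; exists x.
  - by [].
  - by move=> A B _ _ _ x; exfalso; apply: Nempty; exists x.
  - by move=> x; exfalso; apply: Nempty; exists x.
have [c c_dense] := compact_dense_sequence compactM (pi x0).
have C0 : 0 <= C := C_ge0 g_bound x0.
(* The triple [(k, j, n)] is decoded from the 2-adic valuation of [i.+1], so every triple occurs
   infinitely often, as [separating_weights] demands. *)
pose index i : nat * nat * nat :=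
  odflt (0, 0, 0)%N (choice.unpickle (logn 2 i.+1)).
pose v i := chain_value pi psi T compactM g C eps0 c
  (index i).1.1 (index i).1.2 (index i).2.
pose eta i := scale eps0 (index i).2.
pose B i := C + (index i).1.1%:R * dist_bound compactM c (index i).1.2.
have eta0 i : 0 < eta i by exact: scale_gt0.
have v_act i d x : v i (act d x) = v i x + alpha d.
  exact: (chain_value_act _ pi_act actG act_iso psi_act gE eps0_gt0 g_bound).
have v_decr i x y : reach psi T (eta i) x y -> v i y <= v i x.
  exact: (chain_value_decr _ _ eps0_gt0 g_bound).
have v_cont i : continuous (v i).
  exact: (chain_value_continuous pi_continuous pi_open pi_surj pi_fib pi_act actG
    act_iso psiF psi_act T0 g_continuous gE eps0_gt0 g_bound).
have B0 i : 0 <= B i by rewrite addr_ge0// mulr_ge0// dist_bound_ge0.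
have v_bound i x : `|v i x| <= `|g x| + B i.
  have v1 : v i x <= g x + C by exact: (chain_value_le _ _ eps0_gt0 g_bound).
  have v2 : g x - (index i).1.1%:R * dist_bound compactM c (index i).1.2 <= v i x.
    apply: le_trans (chain_value_ge pi _ eps0_gt0 g_bound _ _ _ _ x).
    exact: peak_lower.
  have kr : 0 <= (index i).1.1%:R * dist_bound compactM c (index i).1.2.
    by rewrite mulr_ge0// dist_bound_ge0.
  have := ler_norm (g x); have := lerNnormlW (lexx `|g x|).
  by rewrite /B ler_norml => *; apply/andP; split; lra.
have index_again i m : exists2 j, (m <= j)%N & index j = index i.
  exists (2 ^ logn 2 i.+1 * m.*2.+1).-1.
    rewrite -ltnS prednK ?muln_gt0 ?expn_gt0//.
    apply: (@leq_trans m.*2.+1); first by rewrite ltnS -addnn leq_addr.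
    by rewrite leq_pmull// expn_gt0.
  rewrite /index prednK ?muln_gt0 ?expn_gt0// lognM ?expn_gt0// pfactorK//.
  by rewrite [X in (_ + X)%N]lognE/= dvdn2 /= odd_double addn0.
have index_onto t : exists i, index i = t.
  exists (2 ^ choice.pickle t).-1.
  by rewrite /index prednK ?expn_gt0// pfactorK// choice.pickleK.
have v_const i e x y : e <= eta i -> reach psi T e x y -> reach psi T e y x ->
    v i x = v i y.
  move=> ei xy yx; apply/eqP; rewrite eq_le.
  by rewrite !v_decr//; [exact: reach_le xy|exact: reach_le yx].
(* [v i - v 0] is invariant under [act], hence on recurrent points it takes only its values at
   finitely many representatives. On pairs with [v 0 x - v 0 y] fixed, [v i x - v i y] then takes
   finitely many values. *)
have diff_finite i :
    finite_set [set v i x - v 0%N x | x in [set x | recurrent psi T x]].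
  have [|s reps] := @recurrent_representatives (Num.min (eta i) (eta 0%N)).
    by rewrite lt_min !eta0.
  apply: (@sub_finite_set _ _ [set v i p - v 0%N p | p in [set` s]]); last first.
    by apply: finite_image; apply/finite_seqP; exists s.
  move=> _ [x rx <-]; have [p ps [d [xp px]]] := reps x rx; exists p => //.
  rewrite (v_const i _ _ _ _ xp px) ?ge_min ?lexx//.
  rewrite (v_const 0%N _ _ _ _ xp px) ?ge_min ?lexx ?orbT//.
  by rewrite !v_act; lra.
(* Up to finitely many differences between representatives, these numbers lie in the range of
   [alpha], which is countable. *)
have [e He] : exists e : nat -> R, forall x y, recurrent psi T x ->
    recurrent psi T y -> exists n, v 0%N x - v 0%N y = e n.
  have [s reps] := recurrent_representatives (eta0 0%N).
  have [|e He] := @countable_enumeration _ (\bigcup_(p in [set` s])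
      \bigcup_(q in [set` s]) [set v 0%N p - v 0%N q + a | a in range alpha]).
    have cs : countable [set` s].
      by apply: finite_set_countable; apply/finite_seqP; exists s.
    apply: bigcup_countable => // p _; apply: bigcup_countable => // q _.
    apply: (sub_countable (card_image_le _ _)).
    exact: (alpha_range_countable compactM pi_open pi_surj pi_fib actG act_iso r0
      alpha_sep x0 connectedN).
  exists e => x y rx ry; apply: He.
  have [p ps [d [xp px]]] := reps x rx; have [q qs [d' [yq qy]]] := reps y ry.
  exists p => //; exists q => //; exists (alpha (d - d')); first by exists (d - d').
  rewrite (v_const 0%N _ _ _ _ xp px)// (v_const 0%N _ _ _ _ yq qy)// !v_act.
  by rewrite (raddfD alpha) (raddfN alpha); ring.
pose X := {p : N * N | recurrent psi T p.1 /\ recurrent psi T p.2}.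
pose D i (p : X) := v i (sval p).1 - v i (sval p).2.
have [||||w [Hw sepw]] := @separating_weights R X D (fun i => 2^-1 ^+ i / (1 + B i)) e.
- by move=> i; rewrite divr_gt0 ?exprn_gt0 ?invr_gt0// ltr_wpDr.
- by move=> [[x y] [rx ry]]; exact: He.
- move=> i k; apply: (@sub_finite_set _ _ [set k + a - b | a in
    [set v i x - v 0%N x | x in [set x | recurrent psi T x]] & b in
    [set v i x - v 0%N x | x in [set x | recurrent psi T x]]]); last first.
    by apply: finite_image2.
  move=> _ [[[x y] [/= rx ry]] <- <-]; exists (v i x - v 0%N x); first by exists x.
  by exists (v i y - v 0%N y); [exists y|rewrite /D /=; ring].
- move=> i m; have [j mj jE] := index_again i m; exists j => //.
  by apply/funext => p; rewrite /D /v jE.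
have [||F [W [W0 F_cont F_shift F_mono F_sep]]] :=
    @weighted_sum R N v g B w v_cont g_continuous B0 v_bound.
- by move=> i; have /andP[] := Hw i.
- move=> i; have /andP[_] := Hw i; rewrite ler_pdivlMr//.
  by rewrite ltr_wpDr.
have F_le x y : (forall eps, 0 < eps -> reach psi T eps x y) -> F y <= F x.
  move=> xy; have vxy i : v i y <= v i x by apply: v_decr; exact: xy.
  have := F_mono x y vxy 0%N; have /andP[w0 _] := Hw 0%N.
  have : 0 <= w 0%N * (v 0%N x - v 0%N y) by rewrite mulr_ge0 ?subr_ge0 ?vxy// ltW.
  lra.
have v_sep x y : (forall i, v i x = v i y) -> forall eps, 0 < eps -> reach psi T eps x y.
  move=> vxy; apply: (chain_value_separates pi_open pi_surj pi_fib pi_act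
    actG act_iso psiF psi_act T0 r0 alpha_sep act_ker g_continuous gE eps0_gt0 g_bound
    c_dense) => k j n.
  by have [i iE] := index_onto (k, j, n); have := vxy i; rewrite /v iE.
have F_inj x y : recurrent psi T x -> recurrent psi T y -> F x = F y ->
    forall i, v i x = v i y.
  move=> rx ry Fxy i; apply/eqP; rewrite -subr_eq0; apply/negPn/negP => neq.
  have [k k0 [m Hm]] := sepw (exist _ (x, y) (conj rx ry)) i neq.
  have [m' Hm'] := F_sep x y Fxy _ k0.
  have := Hm _ (leq_maxl m m'); have := Hm' _ (leq_maxr m m').
  by rewrite /D /=; lra.
have F_chain A : recurrence_chain psi T A -> exists2 z, recurrent psi T z &
    A = [set y | recurrent psi T y /\ chain_equiv psi T z y] /\
    forall x, A x -> F x = F z.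
  move=> [z rz ->]; exists z => //; split=> // x [rx [zx xz]].
  apply/eqP; rewrite eq_le !F_le// => eps eps0'; exact: (leads_to_reach psiF T0).
(* [F] shifts by [W * alpha d], so it is normalized by [W]. *)
exists (fun x => F x / W); first split.
- by move=> x; apply: cvgM; [exact: F_cont|exact: cvg_cst].
- by move=> A /F_chain[z rz [_ Fz]] x y /Fz -> /Fz ->.
- move=> A A' /F_chain[z rz [AE Fz]] /F_chain[z' rz' [A'E Fz']] neq x y Ax A'y.
  move=> /(divIf (lt0r_neq0 W0)); rewrite (Fz _ Ax) (Fz' _ A'y) => Fzz'.
  apply: neq; rewrite AE A'E.
  suff sub t t' : recurrent psi T t -> recurrent psi T t' -> F t = F t' ->
      (forall x, [set y | recurrent psi T y /\ chain_equiv psi T t y] x -> F x = F t) ->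
      [set y | recurrent psi T y /\ chain_equiv psi T t y] `<=`
      [set y | recurrent psi T y /\ chain_equiv psi T t' y].
    apply/seteqP; split; apply: sub => //.
    - by rewrite -AE.
    - by rewrite -A'E.
  move=> rt rt' tt' Ft u [ru tu]; split=> //.
  have Fu : F u = F t' by rewrite -tt'; apply: Ft.
  by split; apply: (reach_leads_to psiF T0) => //; apply: v_sep; exact: F_inj.
(* If [F] did not drop, all [v i] would agree at [psi s x] and [psi t x], so [psi s x] would be
   reachable from [psi t x]; shifting by [- t] leads from [x] to [psi (s - t) x], making [x]
   recurrent. *)
- move=> x nrx s t st; rewrite ltr_pdivrMr// divfK ?lt0r_neq0// ltNge.
  apply/negP => Fst; apply: nrx.
  have flow_reach eps : reach psi T eps (psi s x) (psi t x).
    rewrite -(subrK s t) (flowD psiF); apply: reach_flow; last exact: reach_refl.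
    by rewrite subr_ge0 ltW.
  have vts i : v i (psi t x) = v i (psi s x).
    have dec j : v j (psi t x) <= v j (psi s x) by apply: v_decr.
    have := F_mono _ _ dec i; have /andP[w0 _] := Hw i.
    have := dec i; rewrite le_eqVlt => /predU1P[//|lt].
    have : 0 < w i * (v i (psi s x) - v i (psi t x)) by rewrite mulr_gt0// subr_gt0.
    lra.
  apply: (leads_toP psiF T0) => eps eps0'.
  have [e' e'0 shift] := reach_shift T compactM pi_open pi_surj pi_fib actG act_iso psiF
    psi_act (- t) eps0'.
  exists (t - s); first by rewrite subr_gt0.
  have := shift _ _ (v_sep _ _ vts _ e'0).
  by rewrite (flowK psiF) -(flowD psiF) opprB addrC.
- move=> d x; have shift i : v i (act d x) = v i x + alpha d by exact: v_act.
  by rewrite (F_shift _ _ _ shift) mulrDl (mulrC W) mulfK// lt0r_neq0.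
Qed.

End Existence.

(** * Openness and local injectivity of covering projections *)

Lemma covering_map_open (E B : topologicalType) (p : E -> B) : covering_map p ->
  forall x (U : set E), nbhs x U -> nbhs (p x) (p @` U).
Proof.
move=> [_ _ cov] x U nU.
have [U0 [sheets [oU0 U0x _ preim sheetP]]] := cov (p x).
have [S Sx] : exists2 S, sheets S & S x.
  have : (p @^-1` U0) x by [].
  by rewrite preim => -[S sS Sx]; exists S.
have [_ [k [pS kU _ kc [kp pk]]]] := sheetP S Sx.
move=> Sxx; have /subspace_continuousP/(_ (p x) U0x) kcx := kc.
have nkU : nbhs (k (p x)) U by rewrite kp.
have near_k : \forall m \near p x, U0 m -> U (k m) by exact: kcx nkU.
have near_U0 : nbhs (p x) U0 by exact: open_nbhs_nbhs.
apply: filterS (filterI near_k near_U0) => m [km U0m].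
by exists (k m); [exact: km|exact: pk].
Qed.

Lemma covering_metric_injective (R : realType) (M E : metricType R) (p : E -> M)
    (act : H1 R M -> E -> E) : covering_metric p act ->
  exists2 r, 0 < r & forall x y, p x = p y -> mdist x y < r -> x = y.
Proof.
move=> [_ [r r0 iso]]; exists r => // x y pxy xy; apply: mdist_positivity.
rewrite -(iso x x y) ?ballEmdist /= ?mdistxx//.
by rewrite pxy mdistxx.
Qed.

(** * The quotient covering *)

Section KernelQuotient.
Variables (R : realType) (M : metricType R) (alpha : {additive H1 R M -> R}).
Variables (Mhat Malpha : metricType R) (p : continuousType Mhat M).
Variables (act : H1 R M -> Mhat -> Mhat) (q : Mhat -> Malpha) (palpha : Malpha -> M).
Variable actalpha : H1 R M -> Malpha -> Malpha.
Hypothesis uac : universal_abelian_covering p act.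
Hypothesis kq : kernel_quotient alpha p act q palpha actalpha.

Let q_onto y : exists x, q x = y.
Proof.
case: kq => rq _ _ _ _.
have : range q y by rewrite rq.
by move=> [x _ <-]; exists x.
Qed.

Lemma kernel_quotient_continuous : continuous q.
Proof.
case: kq => _ oq _ _ _; apply/continuousP => A oA; exact/oq.
Qed.

(** The saturation of an open set is the union of its translates by the kernel of [alpha]. *)
Lemma kernel_quotient_open x (U : set Mhat) : nbhs x U -> nbhs (q x) (q @` U).
Proof.
case: kq => _ oq qE _ _; case: uac => _ [[act0 actD] act_cont] _ _ _.
rewrite nbhsE => -[V [oV Vx] VU].
have oqV : open (q @` V).
  apply/oq; have -> : q @^-1` (q @` V) =
      \bigcup_(d in [set d | alpha d = 0]) (act d @^-1` V).
    apply/seteqP; split=> [y [v Vv /esym/qE[d d0 vE]]|y [d d0 Vd]].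
      by exists d => //=; rewrite -vE.
    by exists (act d y) => //; apply/esym/qE; exists d.
  by apply: bigcup_open => d _; apply: open_comp => // y _; exact: act_cont.
apply: filterS (open_nbhs_nbhs (conj oqV _)); last by exists x.
by move=> _ [v Vv <-]; exists v => //; exact: VU.
Qed.

Lemma quotient_covering_continuous : continuous palpha.
Proof.
case: kq => _ oq _ pq _; apply/continuousP => A oA; apply/oq.
have -> : q @^-1` (palpha @^-1` A) = p @^-1` A.
  by apply/seteqP; split=> x /=; rewrite pq.
by apply: open_comp => // x _; exact: cts_fun.
Qed.

Lemma quotient_covering_open y (U : set Malpha) :
  nbhs y U -> nbhs (palpha y) (palpha @` U).
Proof.
have [x <-] := q_onto y; case: kq => _ _ _ pq _ nU; rewrite pq.
have := kernel_quotient_continuous nU => /(covering_map_open _) H.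
case: uac => -[_ cov] _ _ _ _.
apply: filterS (H _ p cov) => _ [z Uz <-]; exists (q z) => //.
Qed.

Lemma quotient_covering_onto m : exists y, palpha y = m.
Proof.
case: kq => _ _ _ pq _; case: uac => -[_ [_ rp _]] _ _ _ _.
have : range p m by rewrite rp.
by move=> [x _ <-]; exists (q x).
Qed.

Lemma quotient_covering_fibre y z : palpha y = palpha z ->
  exists d, z = actalpha d y.
Proof.
have [x <-] := q_onto y; have [x' <-] := q_onto z.
case: kq => _ _ _ pq aq; case: uac => _ _ _ pE _.
by rewrite !pq => /pE[d ->]; exists d; rewrite aq.
Qed.

Lemma quotient_covering_act d y : palpha (actalpha d y) = palpha y.
Proof.
have [x <-] := q_onto y; case: kq => _ _ _ pq aq; case: uac => _ _ _ pE _.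
by rewrite aq !pq; apply/esym/pE; exists d.
Qed.

Lemma quotient_group_action : group_action actalpha.
Proof.
case: kq => _ _ _ _ aq; case: uac => _ [[act0 actD] _] _ _ _; split=> [y|d d' y].
  by have [x <-] := q_onto y; rewrite aq act0.
by have [x <-] := q_onto y; rewrite !aq actD.
Qed.

Lemma quotient_act_kernel d y : alpha d = 0 -> actalpha d y = y.
Proof.
have [x <-] := q_onto y; case: kq => _ _ qE _ aq d0; rewrite aq.
by apply/esym/qE; exists d.
Qed.

Lemma quotient_act_free d y : actalpha d y = y -> alpha d = 0.
Proof.
have [x <-] := q_onto y; case: kq => _ _ qE _ aq; rewrite aq => /qE[e e0].
case: uac => _ [[_ actD] _] free _ _; rewrite -actD => /esym/free.
by move=> /(congr1 alpha); rewrite (raddfD alpha) e0 add0r raddf0.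
Qed.

Lemma kernel_quotient_connected : connected [set: Malpha].
Proof.
have <- : q @` [set: Mhat] = [set: Malpha] by case: kq.
case: uac => -[conn _] _ _ _ _.
apply: connected_continuous_connected => //; apply: continuous_subspaceT.
exact: kernel_quotient_continuous.
Qed.

End KernelQuotient.

(** * Lifting chains from the quotient to the universal Abelian covering *)

Lemma isometry_continuous (R : realType) (N : metricType R) (f : N -> N) :
  (forall x y, mdist (f x) (f y) = mdist x y) -> continuous f.
Proof.
by move=> iso; apply/continuous_mdistP => x e e0; exists e => // y; rewrite iso.
Qed.

(** Openness of [q] lifts small displacements near each point; [cocompact_uniform] makes the scale
    uniform, because [q] intertwines the two isometric actions. *)
Lemma open_map_uniform_lift (R : realType) (E N M : metricType R) (H : zmodType)
    (p : E -> M) (act : H -> E -> E) (q : E -> N) (act' : H -> N -> N) :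
  compact [set: M] ->
  (forall x (U : set E), nbhs x U -> nbhs (p x) (p @` U)) ->
  (forall m, exists x, p x = m) ->
  (forall x y, p x = p y -> exists d, y = act d x) ->
  (forall d x y, mdist (act d x) (act d y) = mdist x y) ->
  group_action act' ->
  (forall d x y, mdist (act' d x) (act' d y) = mdist x y) ->
  (forall d x, act' d (q x) = q (act d x)) ->
  continuous q -> (forall x (U : set E), nbhs x U -> nbhs (q x) (q @` U)) ->
  forall eps, 0 < eps -> exists2 e, 0 < e & forall x y, mdist (q x) y < e ->
    exists2 x', q x' = y & mdist x x' < eps.
Proof.
move=> cM p_open p_onto p_fib iso actG' iso' aq q_cont q_open eps eps0.
have [||e e0 He] := cocompact_uniform cM p_open p_onto p_fib
  (Q := fun x s => forall y, mdist (q x) y < s ->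
     exists2 x', q x' = y & mdist x x' < eps).
- move=> x.
  have : nbhs (q x) (q @` [set y | mdist x y < eps / 2]).
    by apply: q_open; apply/near_mdistP; exists (eps / 2); rewrite ?divr_gt0.
  move=> /near_mdistP[s s0 Hs].
  move/continuous_mdistP: q_cont => /(_ x (s / 2))[|s' s'0 Hs']; first by lra.
  exists (Num.min (Num.min s' (eps / 2)) (s / 2)).
    by rewrite !lt_min s'0 !divr_gt0.
  move=> y t; rewrite !lt_min => /andP[/andP[xy1 xy2] _] /andP[_ /andP[_ ts]] z yz.
  have [|x' xx' <-] := Hs z.
    by have := Hs' _ xy1; have := metric_triangle (q x) (q y) z; lra.
  exists x' => //=; have := metric_triangle y x x'; rewrite (metric_sym y x).
  by move: xx' => /=; lra.
- move=> d x s Q y dxy; have [|x' x'E xx'] := Q (act' (- d) y).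
    by rewrite -(iso' d) aq (actNK actG').
  exists (act d x'); last by rewrite iso.
  by rewrite -aq x'E (actNK actG').
exists (e / 2); first by rewrite divr_gt0.
by move=> x y; apply: He; lra.
Qed.

Lemma reach_lift (R : realType) (E N : metricType R) (q : E -> N)
    (psi' : R -> E -> E) (psi : R -> N -> N) (T e eps : R) :
  (forall t x, q (psi' t x) = psi t (q x)) ->
  (forall x y, mdist (q x) y < e -> exists2 x', q x' = y & mdist x x' < eps) ->
  forall x z, reach psi T e (q x) z ->
  exists2 x', q x' = z & reach psi' T eps x x'.
Proof.
move=> qpsi lift x z; elim=> [|t w t0 _ [x' <- xx']|w w' _ [x' <- xx']].
- by exists x => //; exact: reach_refl.
- by exists (psi' t x'); [rewrite qpsi|exact: reach_flow].
- rewrite -qpsi => /lift[x'' <- x'x'']; exists x'' => //.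
  exact: reach_jump xx' x'x''.
Qed.

Theorem theorem3 (R : realType) (n : nat) (M : metricType R)
    (phi : R -> M -> M) (alpha : {additive H1 R M -> R}) (T : R)
    (Mhat : metricType R) (p : continuousType Mhat M)
    (act : H1 R M -> Mhat -> Mhat) (phihat : R -> Mhat -> Mhat)
    (Malpha : metricType R) (q : Mhat -> Malpha) (palpha : Malpha -> M)
    (actalpha : H1 R M -> Malpha -> Malpha)
    (phialpha : R -> Malpha -> Malpha) :
  connected [set: M] -> compact [set: M] -> manifold_with_boundary R n M ->
  flow phi -> 0 < T ->
  universal_abelian_covering p act -> covering_metric p act ->
  flow_lift p phi phihat ->
  kernel_quotient alpha p act q palpha actalpha ->
  covering_metric palpha actalpha ->
  flow_lift palpha phi phialpha ->
  quasi_lyapunov_class alpha act phihat T ->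
  exists f : Malpha -> R,
    lyapunov phialpha T f /\ equivariant alpha actalpha f.
Proof.
move=> _ cM _ _ T0 uac met [flowhat lifthat] kq metalpha [flowalpha liftalpha] quasi.
have [r r0 pi_sep] := covering_metric_injective metalpha.
have [iso _] := met; have [isoalpha _] := metalpha.
have actG := quotient_group_action uac kq.
have pi_open := quotient_covering_open uac kq.
have pi_onto := quotient_covering_onto uac kq.
have pi_fib := quotient_covering_fibre uac kq.
have pi_act := quotient_covering_act uac kq.
have q_cont := kernel_quotient_continuous kq.
have alpha_sep d x : mdist (actalpha d x) x < r -> alpha d = 0.
  by move=> /(pi_sep _ _ (pi_act d x)); exact: (quotient_act_free uac kq).
(* Both sides lift the same curve of [M] with the same starting point. *)
have psi_act t d x : phialpha t (actalpha d x) = actalpha d (phialpha t x).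
  apply: (unique_lifting r0 pi_sep (c1 := fun t => phialpha t (actalpha d x))
    (c2 := fun t => actalpha d (phialpha t x))).
  - exact: flow_continuous_time.
  - move=> s; apply: (@continuous_comp _ _ _ (phialpha ^~ x) (actalpha d)).
      exact: flow_continuous_time.
    exact: isometry_continuous.
  - by move=> s; rewrite pi_act !liftalpha pi_act.
  - by rewrite !flow0.
have [q_onto _ _ pq aq] := kq; have [[_ cov] _ _ pE _] := uac.
have qpsi t x : q (phihat t x) = phialpha t (q x).
  apply: (unique_lifting r0 pi_sep (c1 := fun t => q (phihat t x))
    (c2 := fun t => phialpha t (q x))).
  - move=> s; apply: (@continuous_comp _ _ _ (phihat ^~ x) q).
      exact: flow_continuous_time.
    exact: q_cont.
  - exact: flow_continuous_time.
  - by move=> s; rewrite pq lifthat liftalpha pq.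
  - by rewrite !flow0.
have [g g_cont gE] := equivariant_exists cM pi_open pi_onto pi_fib actG isoalpha r0
  alpha_sep (quotient_act_kernel kq).
(* The hypothesis on [alpha] concerns [Mhat], so [g] is pulled back by [q]; the bound then returns
   to [Malpha] by lifting chains. *)
have [||C [eps [C0 eps0 g_quasi]]] := quasi (g \o q).
- by move=> x; apply: continuous_comp; [exact: q_cont|exact: g_cont].
- by move=> d x; rewrite /= -aq gE.
have p_onto m : exists x, p x = m.
  have : range p m by case: cov => _ -> _.
  by move=> [x _ <-]; exists x.
have [e e0 lift] := open_map_uniform_lift cM (covering_map_open cov)
  p_onto (fun x y => (pE x y).1) iso actG isoalpha aq q_cont
  (kernel_quotient_open uac kq) eps0.
have g_bound x z : reach phialpha T e x z -> g z <= g x + C.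
  have : range q x by rewrite q_onto.
  move=> [x' _ <-] /(reach_lift qpsi lift)[z' <- xz].
  (* The end of the chain must be a value of the pseudo-orbit at a time before [l]; the tail of
     length [1] puts it at [l - 1]. *)
  have [l [gamma [po sl <- <- _]]] := reach_pseudo_orbit flowhat T0 xz ltr01.
  have := g_quasi _ _ po (l - 1); rewrite /= => H; have := H _; lra.
have [f lyap fE] := equivariant_lyapunov_exists cM (kernel_quotient_connected uac kq)
  (quotient_covering_continuous kq) pi_open pi_onto pi_fib pi_act actG isoalpha
  flowalpha psi_act T0 r0 alpha_sep (quotient_act_kernel kq) g_cont gE e0 g_bound.
by exists f.
Qed.
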